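(* Consider the message passing model on a connected undirected graph $G=(V,E)$ with $m$ vertices and diameter $d$, where the $i$-th player is given as input $X_i \in \mathbb{Z}^n_{\geq 0}$ (with entries at most $M$) and $\mathcal{X} = \sum_{i=1}^m X_i$. Let $\epsilon \in (0,1)$. Then there is a communication protocol which outputs an estimate $\tilde{\mathcal{X}} \in \mathbb{R}^n$ of $\mathcal{X}$ such that \[ \|\tilde{\mathcal{X}} - \mathcal{X}\|_\infty \leq \epsilon \|\mathcal{X}_{\mathrm{tail}(1/\epsilon^2)}\|_2 \] with probability $1-1/n^c$, for any constant $c \geq 1$. The protocol uses $O\!\left(\frac{m}{\epsilon^2}\log(n)(\log\log n + \log d + \log(1/\epsilon))\right)$ total communication and a max communication of $O\!\left(\frac{1}{\epsilon^2}\log(n)(\log\log n + \log d + \log(1/\epsilon))\right)$.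
   Context: For a vector $\mathcal{X} \in \mathbb{R}^n$ and integer $k$, $\mathcal{X}_{\mathrm{tail}(k)}$ is the vector $\mathcal{X}$ with its $k$ largest (in absolute value) entries set to $0$. Message passing model: there are $m$ players, one at each vertex of a connected undirected graph $G$ known to all players; player $i$ receives only $X_i$; a player may send a message only to a neighbor in $G$, received only by that neighbor; the players share a public random string; at termination a pre-specified player holds the output. Total communication is the total number of bits sent; max communication is the maximum number of bits sent across any single edge. Standing assumption: $m, M = O(n^{c'})$ for a constant $c'$, so $\log(nmM)=O(\log n)$. *)

(* Defs.v *)
From mathcomp Require Import all_boot all_order all_algebra.
From mathcomp Require Import all_classical all_reals all_analysis.

Set Implicit Arguments.
Unset Strict Implicit.
Unset Printing Implicit Defensive.

Import Order.TTheory GRing.Theory Num.Theory.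
Local Open Scope ring_scope.

Definition walk (V : finType) (e : rel V) (k : nat) (x y : V) : bool :=
  [exists p : k.-tuple V, path e x p && (last x p == y)].

(* Least length of a walk; it is #|V| when y is not reachable from x. *)
Definition gdist (V : finType) (e : rel V) (x y : V) : nat :=
  find (fun k => walk e k x y) (iota 0 #|V|).

Definition diameter (V : finType) (e : rel V) : nat :=
  (\max_(x : V) \max_(y : V) gdist e x y)%N.

(* Ties are broken towards smaller indices; the multiset of remaining absolute
   values does not depend on this choice. *)
Definition top (R : realType) (n k : nat) (x : 'rV[R]_n) : seq 'I_n :=
  take k (sort (fun i j => `|x 0 j| <= `|x 0 i|) (enum 'I_n)).

Definition tail (R : realType) (n k : nat) (x : 'rV[R]_n) : 'rV[R]_n :=
  \row_i (if i \in top k x then 0 else x 0 i).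

Definition l2norm (R : realType) (n : nat) (x : 'rV[R]_n) : R :=
  Num.sqrt (\sum_i x 0 i ^+ 2).

(* A channel is an ordered pair (u, v); its log lists, round by round, the bit
   sent from u to v, with None for a round in which nothing is sent. *)
Definition chan_log : Type := seq (option bool).

(* Public-coin message passing protocol with r shared random bits.  In each round
   every player may send one bit to each neighbour; longer messages take several
   rounds.
   [turn u v w luv lvu] says whether u sends a bit to v in the next round.  It may
   depend only on the public string w and on the logs of the two channels between
   u and v, so both endpoints know in advance whether a bit is due.  Hence silence
   and timing carry no information, and every bit of information that crosses an
   edge is counted.
   [bit u v x w rcv] is the bit that u then sends to v; it depends on the input x
   of u, on w, and on the logs rcv of the channels into u.
   [output x w rcv] is the output of the player holding the output, computed from
   its own input, w, and the logs of the channels into it. *)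
Record protocol (V : finType) (In Out : Type) (r : nat) := Protocol {
  rounds : nat;
  turn : V -> V -> r.-tuple bool -> chan_log -> chan_log -> bool;
  bit : V -> V -> In -> r.-tuple bool -> (V -> chan_log) -> bool;
  output : In -> r.-tuple bool -> (V -> chan_log) -> Out }.

Section Execution.
Variables (V : finType) (e : rel V) (In Out : Type) (r : nat).
Variables (P : protocol V In Out r) (X : V -> In) (w : r.-tuple bool).

(* The log of channel (u, v) after t rounds. *)
Fixpoint logs (t : nat) : V -> V -> chan_log :=
  if t is t'.+1 then
    let h := logs t' in
    fun u v => rcons (h u v)
      (if e u v && turn P u v w (h u v) (h v u)
       then Some (bit P u v (X u) w (fun z => h z u)) else None)
  else fun _ _ => [::].

Definition bits_sent (u v : V) : nat := count isSome (logs (rounds P) u v).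

Definition total_comm : nat := (\sum_(u : V) \sum_(v : V) bits_sent u v)%N.

(* The bits sent across the edge {u, v} are those sent in either direction. *)
Definition max_comm : nat :=
  (\max_(u : V) \max_(v : V) (bits_sent u v + bits_sent v u))%N.

Definition result (root : V) : Out :=
  output P (X root) w (fun z => logs (rounds P) z root).

End Execution.

Definition coin_prob (R : realType) (r : nat) (E : pred (r.-tuple bool)) : R :=
  #|E|%:R / (2 ^ r)%:R.

(* Main.v *)
(** Messages travel up a breadth-first tree.  A vertex holds a CountSketch (signed
    hash buckets) of the sum of its subtree.  It chooses the k-sparse list whose
    sketch comes closest to the one it holds, in sup norm, sends that list exactly,
    and sends the residual counters in floating point with a short mantissa, rounded
    at random without bias.  Since the restriction of the true sum to the k largest
    coordinates of the final answer is one of the candidates, every residual is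
    bounded by the tail of the subtree sum, however large the heavy coordinates are;
    so rounding errors are relative to the tail.  They are martingale differences
    along the tree, and the squares of the tails of the nonnegative subtree sums add
    up to at most (d + 1) times the square of the total tail; a mantissa of
    O(log log n + log d + log (1/eps)) bits therefore suffices.  The root recovers
    each coordinate by a majority vote over the O(log n) rows of the sketch. *)

Require Import Defs.
From mathcomp Require Import all_boot all_order all_algebra.
From mathcomp Require Import all_classical all_reals all_analysis.
From mathcomp Require Import lra ring zify.

Set Implicit Arguments.
Unset Strict Implicit.
Unset Printing Implicit Defensive.

Import Order.TTheory GRing.Theory Num.Theory.
Local Open Scope ring_scope.

(** * Concentration on finite product spaces *)

Section Average.
Variable R : realType.

Definition avg (T : finType) (f : T -> R) : R := (\sum_x f x) / #|T|%:R.

Definition prob (T : finType) (E : pred T) : R := #|E|%:R / #|T|%:R.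

Lemma avg_le (T : finType) (f g : T -> R) : (forall x, f x <= g x) -> avg f <= avg g.
Proof.
by move=> fg; rewrite ler_wpM2r ?invr_ge0 ?ler0n// ler_sum.
Qed.

Lemma eq_avg (T : finType) (f g : T -> R) : f =1 g -> avg f = avg g.
Proof. by move=> fg; congr (_ / _); apply: eq_bigr => x _. Qed.

Lemma avg_const (T : finType) (a : R) : (0 < #|T|)%N -> avg (fun _ : T => a) = a.
Proof.
move=> T0; rewrite /avg sumr_const -[a *+ _]mulr_natr mulfK//.
by rewrite pnatr_eq0 -lt0n.
Qed.

Lemma avgZ (T : finType) (a : R) (f : T -> R) : avg (fun x => a * f x) = a * avg f.
Proof. by rewrite /avg -mulr_sumr mulrA. Qed.

Lemma avgD (T : finType) (f g : T -> R) : avg (fun x => f x + g x) = avg f + avg g.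
Proof. by rewrite /avg big_split/= mulrDl. Qed.

Lemma avg_sum (T J : finType) (P : pred J) (f : J -> T -> R) :
  avg (fun x => \sum_(j | P j) f j x) = \sum_(j | P j) avg (f j).
Proof. by rewrite /avg exchange_big/= mulr_suml. Qed.

Lemma prob_avg (T : finType) (E : pred T) : prob E = avg (fun x => (E x)%:R).
Proof.
rewrite /prob /avg; congr (_ / _).
by rewrite -sum1_card natr_sum big_mkcond/=; apply: eq_bigr => x _; rewrite -topredE/=; case: (E x).
Qed.

Lemma prob_sub (T : finType) (E F : pred T) : (forall x, E x -> F x) -> prob E <= prob F.
Proof.
move=> EF; rewrite !prob_avg; apply: avg_le => x.
by case: (E x) (EF x) => // ->.
Qed.

Lemma prob_exists (T J : finType) (E : J -> pred T) :
  prob [pred x | [exists j, E j x]] <= \sum_j prob (E j).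
Proof.
rewrite prob_avg (eq_bigr _ (fun j _ => prob_avg (E j))) -avg_sum.
apply: avg_le => x /=; case: existsP => [[j Ej]|_]; last by apply: sumr_ge0.
by rewrite (bigD1 j)//= Ej lerDl sumr_ge0.
Qed.

Lemma prob_or (T : finType) (E F : pred T) :
  prob [pred x | E x || F x] <= prob E + prob F.
Proof.
rewrite !prob_avg -avgD; apply: avg_le => x /=.
by case: (E x); case: (F x) => //=; rewrite ?addr0 ?add0r ?lerDl.
Qed.

Lemma prob_compl (T : finType) (E : pred T) : (0 < #|T|)%N ->
  prob [pred x | ~~ E x] = 1 - prob E.
Proof.
move=> T0; apply/eqP; rewrite eq_sym subr_eq !prob_avg -avgD -[eqbLHS](@avg_const T)//.
by apply/eqP/eq_avg => x /=; case: (E x); rewrite ?addr0 ?add0r.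
Qed.

Lemma prob_markov (T : finType) (f : T -> R) (a : R) : (forall x, 0 <= f x) -> 0 < a ->
  prob [pred x | a <= f x] <= avg f / a.
Proof.
move=> f0 a0; rewrite mulrC -avgZ prob_avg; apply: avg_le => x /=.
case: (leP a (f x)) => [af|_]; first by rewrite mulrC ler_pdivlMr// mul1r.
by rewrite mulr_ge0// invr_ge0 ltW.
Qed.

(* Stands in for Hoeffding's lemma: the linear term averages to 0. *)
Lemma expR_le_add_sqr (x : R) : expR x <= x + expR (2 * x ^+ 2).
Proof.
have := expR_ge1Dx (2 * x ^+ 2).
have x2 : 0 <= x ^+ 2 by exact: sqr_ge0.
case: (lerP x (2^-1)) => [xh|xh] H; last first.
  have : x <= 2 * x ^+ 2 by nra.
  rewrite -ler_expR => /le_trans; apply; rewrite lerDr; lra.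
apply: (@le_trans _ _ (x + (1 + 2 * x ^+ 2))); last by rewrite lerD2l.
have x1 : 0 < 1 - x by lra.
apply: (@le_trans _ _ (1 - x)^-1).
  rewrite -[x in leLHS]opprK expRN lef_pV2 ?posrE ?expR_gt0//.
  exact: expR_ge1Dx.
rewrite -[leLHS]mul1r ler_pdivrMr//; nra.
Qed.

Section Product.
Variables (I D : finType).
Hypothesis D0 : (0 < #|D|)%N.
Notation Omega := {ffun I -> D}.

Lemma card_Omega_gt0 : (0 < #|{ffun I -> D}|)%N.
Proof. by rewrite card_ffun expn_gt0 D0. Qed.

Definition splice (A : {set I}) (x w : Omega) : Omega :=
  [ffun i => if i \in A then x i else w i].

(* Exchanging the coordinates in A between two independent samples is a
   measure-preserving involution. *)
Lemma avg_splice (A : {set I}) (f : Omega -> R) :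
  avg (fun w => avg (fun x => f (splice A x w))) = avg f.
Proof.
transitivity ((\sum_(p : Omega * Omega) f (splice A p.2 p.1)) / #|{ffun I -> D}|%:R / #|{ffun I -> D}|%:R).
  rewrite /avg -mulr_suml; congr (_ / _ / _).
  by rewrite pair_big.
pose h (p : Omega * Omega) := (splice A p.2 p.1, splice A p.1 p.2).
have hK : cancel h h.
  move=> [w x]; rewrite /h /=; congr (_, _); apply/ffunP => i; rewrite !ffunE;
  by case: (i \in A).
rewrite (reindex h)/=; last by exists h => p _; rewrite hK.
have -> : \sum_p f (splice A (splice A p.1 p.2) (splice A p.2 p.1)) = \sum_(p : Omega * Omega) f p.1.
  by apply: eq_bigr => p _; rewrite -[RHS](congr1 (fun q => f q.1) (hK p)).
rewrite -(pair_bigA _ (fun w _ => f w))/=.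
under eq_bigr => w _ do rewrite sumr_const -[f w *+ _]mulr_natr.
rewrite -mulr_suml mulfK//.
by rewrite pnatr_eq0 -lt0n card_Omega_gt0.
Qed.

Lemma avg_marginal (v : I) (f : D -> R) : avg (fun w : Omega => f (w v)) = avg f.
Proof.
have cD : #|D|%:R != 0 :> R by rewrite pnatr_eq0 -lt0n.
pose F (i : I) d := if i == v then f d else 1.
have E (w : Omega) : f (w v) = \prod_i F i (w i).
  rewrite (bigD1 v)//= big1 ?mulr1 /F ?eqxx// => i /negPf ->//.
rewrite /avg (eq_bigr _ (fun w _ => E w)) -(bigA_distr_bigA F) (bigD1 v)//=.
have -> : \prod_(i | i != v) \sum_j F i j = #|D|%:R ^+ #|I|.-1 :> R.
  transitivity (\prod_(i | i != v) #|D|%:R : R).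
    by apply: eq_bigr => i /negPf iv; rewrite /F iv sumr_const.
  by rewrite prodr_const cardC1.
have -> : \sum_j F v j = \sum_d f d by apply: eq_bigr => d _; rewrite /F eqxx.
rewrite card_ffun natrX.
have I0 : (0 < #|I|)%N by apply/card_gt0P; exists v.
rewrite -mulrA -[in X in _ / X](prednK I0); congr (_ * _).
by rewrite exprSr invfM mulrA divff ?mul1r ?expf_neq0.
Qed.

Section Adapted.
Variables (T : finType) (P : {set T}) (A : T -> {set I}) (rk : T -> nat).

Definition adapted (g : T -> Omega -> R) := forall u v x w, u \in P -> v \in P ->
  u != v -> (rk v <= rk u)%N -> g u (splice (A v) x w) = g u w.

Lemma avg_prod_le (g : T -> Omega -> R) (a : T -> R) : adapted g ->
  (forall u w, u \in P -> 0 <= g u w) ->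
  (forall v w, v \in P -> avg (fun x => g v (splice (A v) x w)) <= a v) ->
  avg (fun w => \prod_(v in P) g v w) <= \prod_(v in P) a v.
Proof.
move=> ad g0 ga.
suff H m (Q : {set T}) : Q \subset P -> #|Q| = m ->
    avg (fun w => \prod_(v in Q) g v w) <= \prod_(v in Q) a v by apply: H.
elim: m Q => [|m IH] Q QP Qm.
  move/eqP: Qm; rewrite cards_eq0 => /eqP ->.
  rewrite big_set0 (eq_avg (g := fun=> 1)) ?avg_const ?card_Omega_gt0//.
  by move=> w; rewrite big_set0.
have /set0Pn[v0 v0Q] : Q != finset.set0 by rewrite -card_gt0 Qm.
case: (arg_minnP rk v0Q) => v vQ vmin.
have QPs : {subset Q <= P} by exact/fintype.subsetP.
have vP : v \in P by exact: QPs vQ.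
have a0 : 0 <= a v.
  have [w _] : exists w : Omega, w \in [set: Omega].
    by apply/set0Pn; rewrite -card_gt0 cardsT card_Omega_gt0.
  by apply: le_trans (ga v w vP); rewrite divr_ge0// sumr_ge0// => x _; exact: g0.
rewrite -(avg_splice (A v)) (bigD1 v)//=.
apply: (@le_trans _ _ (avg (fun w => a v * \prod_(u in Q :\ v) g u w))).
  apply: avg_le => w.
  rewrite (eq_avg (g := fun x => (\prod_(u in Q :\ v) g u w) * g v (splice (A v) x w))).
    rewrite avgZ mulrC ler_wpM2r//; last exact: ga.
    by apply: prodr_ge0 => u; rewrite !inE => /andP[_ /QPs] /g0.
  move=> x; rewrite (bigD1 v)//= mulrC; congr (_ * _).
  apply: eq_big => [u|u /andP[uQ uv]]; first by rewrite !inE andbC.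
  by apply: ad; rewrite ?QPs ?vmin.
rewrite avgZ ler_wpM2l//.
have -> : \prod_(u in Q | u != v) a u = \prod_(u in Q :\ v) a u.
  by apply: eq_bigl => u; rewrite !inE andbC.
apply: IH; first exact: fintype.subset_trans (finset.subsetDl _ _) QP.
by move: Qm; rewrite (cardsD1 v) (vQ : v \in Q) => -[].
Qed.

Section Sums.
Variable f : T -> Omega -> R.
Hypothesis ad : adapted f.
Hypothesis f0 : forall v w, v \in P -> avg (fun x => f v (splice (A v) x w)) = 0.

Lemma avg_sqr_sum :
  avg (fun w => (\sum_(v in P) f v w) ^+ 2) = \sum_(v in P) avg (fun w => f v w ^+ 2).
Proof.
under eq_avg do rewrite expr2 big_distrlr/=.
rewrite avg_sum; apply: eq_bigr => u uP.
rewrite avg_sum (bigD1 u)//= big1 ?addr0// => v /andP[vP vu].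
case: (leqP (rk v) (rk u)) => [le|/ltnW le].
  rewrite -(avg_splice (A v)) (eq_avg (g := fun=> 0)) ?avg_const ?card_Omega_gt0// => w.
  transitivity (avg (fun x => f u w * f v (splice (A v) x w))).
    by apply: eq_avg => x; rewrite ad// eq_sym.
  by rewrite avgZ f0// mulr0.
rewrite -(avg_splice (A u)) (eq_avg (g := fun=> 0)) ?avg_const ?card_Omega_gt0// => w.
transitivity (avg (fun x => f v w * f u (splice (A u) x w))).
  by apply: eq_avg => x; rewrite mulrC (ad (u := v)).
by rewrite avgZ f0// mulr0.
Qed.

Variables (c : T -> R) (W : R).
Hypothesis fc : forall v w, v \in P -> `|f v w| <= c v.
Hypothesis W0 : 0 <= W.
Hypothesis cW : \sum_(v in P) c v ^+ 2 <= W ^+ 2.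

Lemma avg_expR_sum (lam : R) :
  avg (fun w => expR (lam * \sum_(v in P) f v w)) <= expR (2 * lam ^+ 2 * W ^+ 2).
Proof.
under eq_avg do rewrite mulr_sumr expR_sum.
apply: (@le_trans _ _ (\prod_(v in P) expR (2 * (lam * c v) ^+ 2))); last first.
  rewrite -expR_sum ler_expR -mulr_sumr -mulrA ler_wpM2l//.
  under eq_bigr do rewrite exprMn.
  by rewrite -mulr_sumr ler_wpM2l// sqr_ge0.
apply: (avg_prod_le (g := fun v w => expR (lam * f v w))).
- by move=> u v x w uP vP uv le; rewrite ad.
- by move=> u w _; exact: expR_ge0.
move=> v w vP.
apply: (@le_trans _ _ (avg (fun x => lam * f v (splice (A v) x w) + expR (2 * (lam * c v) ^+ 2)))).
  apply: avg_le => x; apply: le_trans (expR_le_add_sqr _) _.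
  rewrite lerD2l ler_expR ler_wpM2l// -[leLHS]real_normK ?num_real//.
  rewrite -[leRHS]real_normK ?num_real// lerXn2r ?nnegrE//.
  by rewrite !normrM ler_wpM2l// (le_trans (fc _ vP))// ler_norm.
by rewrite [leLHS](avgD (fun x => lam * f v (splice (A v) x w)) (fun=> expR (2 * (lam * c v) ^+ 2))) avgZ f0// mulr0 add0r avg_const// card_Omega_gt0.
Qed.

Lemma prob_sum_gt (s : R) : 0 <= s ->
  prob [pred w | s * W < \sum_(v in P) f v w] <= expR (- (s ^+ 2 / 8)).
Proof.
move=> s0; have [Weq0|Wn0] := eqVneq W 0; last first.
  have Wp : 0 < W by rewrite lt0r Wn0.
  pose lam := s / (4 * W).
  have lam0 : 0 <= lam by rewrite divr_ge0 ?mulr_ge0.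
  apply: le_trans (prob_sub (F := [pred w | expR (lam * (s * W)) <=
    expR (lam * \sum_(v in P) f v w)]) _) _.
    by move=> w /= H; rewrite ler_expR ler_wpM2l// ltW.
  apply: le_trans (prob_markov _ _) _ => [w||]; rewrite ?expR_ge0 ?expR_gt0//.
  rewrite -expRN; apply: le_trans (ler_wpM2r (expR_ge0 _) (avg_expR_sum _)) _.
  rewrite -expRD ler_expR le_eqVlt; apply/orP; left; apply/eqP.
  by rewrite /lam; field.
rewrite Weq0 mulr0 (_ : prob _ = 0) ?expR_ge0//.
rewrite prob_avg (eq_avg (g := fun=> 0)) ?avg_const ?card_Omega_gt0// => w /=.
rewrite big1 ?ltxx// => v vP.
have cv0 : c v ^+ 2 <= 0.
  move: cW; rewrite Weq0 expr0n/=; apply: le_trans.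
  by rewrite (bigD1 v)//= lerDl sumr_ge0// => u _; exact: sqr_ge0.
have cv : c v = 0 by apply/eqP; rewrite -sqrf_eq0 eq_le cv0 sqr_ge0.
by apply/eqP; rewrite -normr_le0 -cv fc.
Qed.

End Sums.

Lemma prob_norm_sum_gt (f : T -> Omega -> R) (c : T -> R) (W s : R) : adapted f ->
  (forall v w, v \in P -> avg (fun x => f v (splice (A v) x w)) = 0) ->
  (forall v w, v \in P -> `|f v w| <= c v) -> 0 <= W ->
  \sum_(v in P) c v ^+ 2 <= W ^+ 2 -> 0 <= s ->
  prob [pred w | s * W < `|\sum_(v in P) f v w|] <= 2 * expR (- (s ^+ 2 / 8)).
Proof.
move=> ad f0 fc W0 cW s0.
apply: (@le_trans _ _ (prob [pred w | (s * W < \sum_(v in P) f v w) ||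
                                      (s * W < \sum_(v in P) - f v w)])).
  by apply: prob_sub => w /=; rewrite sumrN ltr_normr.
rewrite mulr_natl mulr2n; apply: le_trans (prob_or _ _) _; apply: lerD.
  by apply: le_trans (prob_sum_gt ad f0 fc W0 cW s0); exact: prob_sub.
have ad' : adapted (fun v w => - f v w) by move=> u v x w uP vP uv le; rewrite ad.
apply: le_trans (prob_sum_gt ad' (c := c) (W := W) _ _ W0 cW s0); first exact: prob_sub.
- move=> v w vP; rewrite (eq_avg (g := fun x => -1 * f v (splice (A v) x w))).
    by rewrite avgZ f0// mulr0.
  by move=> x; rewrite mulN1r.
- by move=> v w vP; rewrite normrN fc.
Qed.
End Adapted.
End Product.
End Average.

(** * Convergecast along a breadth-first tree *)

Section BFS.
Variables (V : finType) (e : rel V) (root : V).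
Hypothesis conn : forall u v : V, connect e u v.

Lemma walkP (k : nat) (x y : V) :
  reflect (exists p, [/\ size p = k, path e x p & last x p = y]) (walk e k x y).
Proof.
apply: (iffP existsP) => [[p /andP[ep /eqP lp]]|[p [sp ep lp]]].
  by exists p; rewrite size_tuple.
have sz : size p == k by apply/eqP.
by exists (Tuple sz); rewrite /= ep lp eqxx.
Qed.

Lemma gdist_le (k : nat) (x y : V) : walk e k x y -> (gdist e x y <= k)%N.
Proof.
move=> w; rewrite /gdist leqNgt; apply/negP => lt.
case: (ltnP k #|V|) => kV.
  have := before_find 0%N lt; rewrite nth_iota// add0n; by rewrite w.
have := leq_trans lt (find_size _ _).
by rewrite size_iota ltnNge kV.
Qed.

Lemma walk_gdist (x y : V) : walk e (gdist e x y) x y.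
Proof.
have [p ep ->] := connectP (conn x y).
case/shortenP: ep => p' ep' up' _.
have lt : (size p' < #|V|)%N by have := card_uniqP up'; rewrite /= => <-; exact: max_card.
have hw : has (fun k => walk e k x (last x p')) (iota 0 #|V|).
  apply/hasP; exists (size p'); first by rewrite mem_iota.
  by apply/walkP; exists p'.
have := nth_find 0%N hw; rewrite nth_iota ?add0n//.
by move: hw; rewrite has_find size_iota.
Qed.

Lemma gdist_diameter x y : (gdist e x y <= diameter e)%N.
Proof.
by rewrite /diameter (bigD1 x)//= leq_max (bigD1 y)//= leq_max leqnn.
Qed.

Lemma gdist_eq0 x y : (gdist e x y == 0) = (x == y).
Proof.
apply/eqP/eqP => [d0|->].
  by have := walk_gdist x y; rewrite d0 => /walkP[p [/size0nil -> _]].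
by apply/eqP; rewrite -leqn0 gdist_le//; apply/walkP; exists [::].
Qed.

Lemma bfs_parent : exists par : V -> V, forall v, v != root ->
  e (par v) v /\ gdist e root v = (gdist e root (par v)).+1.
Proof.
suff H v : exists u, v != root -> e u v /\ gdist e root v = (gdist e root u).+1.
  have [f Hf] := choice H; by exists f.
case: (eqVneq v root) => [->|vr]; first by exists root.
have /walkP[p [sp ep lp]] := walk_gdist root v.
case/lastP: p sp ep lp => [_ _ /= rv|p z]; first by rewrite rv eqxx in vr.
rewrite size_rcons last_rcons rcons_path => sp /andP[ep elz] zv.
subst z; exists (last root p) => _; split => //.
rewrite -sp; congr _.+1; apply/eqP; rewrite eqn_leq; apply/andP; split; last first.
  by apply: gdist_le; apply/walkP; exists p.
rewrite -ltnS sp; apply: gdist_le.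
have /walkP[q [sq eq lq]] := walk_gdist root (last root p).
apply/walkP; exists (rcons q v); rewrite size_rcons sq rcons_path lq eq last_rcons.
by move: elz; rewrite /= => ->.
Qed.

End BFS.

Section Tree.
Variables (V : finType) (root : V) (par : V -> V) (dep : V -> nat) (D : nat).
Hypothesis dep0 : forall v, (dep v == 0) = (v == root).
Hypothesis depS : forall v, v != root -> dep v = (dep (par v)).+1.
Hypothesis depD : forall v, (dep v <= D)%N.

Definition child (c v : V) := (c != root) && (par c == v).

Lemma child_dep c v : child c v -> dep c = (dep v).+1.
Proof. by move=> /andP[cr /eqP <-]; exact: depS. Qed.

Lemma depth_ind (P : V -> Prop) :
  (forall v, (forall u, (dep v < dep u)%N -> P u) -> P v) -> forall v, P v.
Proof.
move=> H v; have [m] := ubnP (D - dep v); elim: m v => // m IH v lt.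
by apply: H => u uv; apply: IH; have := depD u; lia.
Qed.

Definition sub (u v : V) := (dep v <= dep u)%N && (iter (dep u - dep v) par u == v).

Lemma dep_iter j u : (j <= dep u)%N -> dep (iter j par u) = (dep u - j)%N.
Proof.
elim: j => [|j IH] ju /=; first by rewrite subn0.
have := IH (ltnW ju); have := @depS (iter j par u).
rewrite -dep0; lia.
Qed.

Lemma sub_refl v : sub v v.
Proof. by rewrite /sub leqnn subnn /= eqxx. Qed.

Lemma sub_root u : sub u root.
Proof.
have /eqP r0 : dep root == 0%N by rewrite dep0.
by rewrite /sub r0 subn0 -dep0 dep_iter ?subnn.
Qed.

Lemma sub_dep u v : sub u v -> u != v -> (dep v < dep u)%N.
Proof.
move=> /andP[le /eqP it] uv; rewrite ltn_neqAle le andbT.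
by apply: contraNneq uv => de; rewrite -it de subnn /=.
Qed.

Lemma sub_childE u v : sub u v -> u != v ->
  child (iter (dep u - dep v).-1 par u) v /\ sub u (iter (dep u - dep v).-1 par u).
Proof.
move=> suv uv; have lt := sub_dep suv uv.
have {suv} /andP[_ /eqP it] := suv.
set j := (dep u - dep v).-1; have jE : (dep u - dep v = j.+1)%N by rewrite /j; lia.
have dj : dep (iter j par u) = (dep u - j)%N by apply: dep_iter; lia.
split.
  rewrite /child; rewrite jE /= in it; rewrite it eqxx andbT -dep0 dj; lia.
rewrite /sub dj; apply/andP; split; first by lia.
by rewrite subKn//; lia.
Qed.

Lemma sub_child_uniq u v c : child c v -> sub u c ->
  [/\ sub u v, u != v & iter (dep u - dep v).-1 par u = c].
Proof.
move=> cv /andP[le /eqP it]; have dc := child_dep cv.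
have jE : ((dep u - dep v).-1 = dep u - dep c)%N by lia.
rewrite jE it; split => //.
  rewrite /sub; apply/andP; split; first by lia.
  have -> : (dep u - dep v = (dep u - dep c).+1)%N by lia.
  by rewrite /= it; case/andP: cv.
by apply/negP => /eqP uv; rewrite uv in le; lia.
Qed.

Lemma sum_strict_sub (M : nmodType) (v : V) (F : V -> M) :
  \sum_(u | sub u v && (u != v)) F u = \sum_(c | child c v) \sum_(u | sub u c) F u.
Proof.
rewrite (partition_big (fun u => iter (dep u - dep v).-1 par u) (fun c => child c v))/=.
  apply: eq_bigr => c cv; apply: eq_bigl => u.
  apply/andP/idP => [[/andP[su uv] /eqP <-]|sc].
    by case: (sub_childE su uv).
  by have [-> -> ->] := sub_child_uniq cv sc; rewrite eqxx.
by move=> u /andP[su uv]; case: (sub_childE su uv).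
Qed.

Lemma sum_sub (M : nmodType) (v : V) (F : V -> M) :
  \sum_(u | sub u v) F u = F v + \sum_(c | child c v) \sum_(u | sub u c) F u.
Proof. by rewrite (bigD1 v) ?sub_refl//= sum_strict_sub. Qed.

Section Aggregation.
Variables (In Msg : Type) (step : V -> In -> (V -> option Msg) -> Msg).

Definition from_children (msg : V -> Msg) (v : V) : V -> option Msg :=
  fun c => if child c v then Some (msg c) else None.

Fixpoint run (X : V -> In) (h : nat) (v : V) : Msg :=
  step v (X v) (fun c => if h is h'.+1 then from_children (run X h') v c else None).

Definition message (X : V -> In) (v : V) : Msg := run X (D - dep v) v.

Lemma messageE X v : message X v = step v (X v) (from_children (message X) v).
Proof.
rewrite /message; case hE : (D - dep v)%N => [|h] /=; congr step; apply/funext => c;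
  rewrite /from_children; case: ifP => // /child_dep dc; have := depD c => ?.
  by lia.
by congr (Some (run _ _ _)); lia.
Qed.

End Aggregation.

Section Protocol.
Variables (e : rel V) (In Out : Type) (Msg : finType) (r L : nat).
Hypothesis card_Msg : (#|Msg| <= 2 ^ L)%N.
Hypothesis e_par : forall v, v != root -> e v (par v).
Variable step : r.-tuple bool -> V -> In -> (V -> option Msg) -> Msg.
Variable out : r.-tuple bool -> In -> (V -> option Msg) -> Out.

Lemma bit_code : exists (enc : Msg -> seq bool) (dec : seq bool -> option Msg),
  (forall m, size (enc m) = L) /\ (forall m, dec (enc m) = Some m).
Proof.
pose b0 : L.-tuple bool := nseq_tuple L false.
exists (fun m => val (nth b0 (enum {: L.-tuple bool}) (index m (enum Msg)))).
exists (fun s => oapp (fun b : L.-tuple bool => onth (enum Msg) (index b (enum {: L.-tuple bool}))) None (insub s)).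
split=> [m|m]; first by rewrite size_tuple.
rewrite valK /= index_uniq ?enum_uniq//.
  by rewrite onthE (nth_map m) ?index_mem ?nth_index ?mem_enum.
rewrite -cardE card_tuple card_bool; apply: leq_trans card_Msg.
by rewrite cardE index_mem mem_enum.
Qed.

Lemma tree_protocol : exists P : protocol V In Out r, forall X w msg,
  (forall v, msg v = step w v (X v) (from_children msg v)) ->
  [/\ result e P X w root = out w (X root) (from_children msg root),
      (total_comm e P X w <= #|V| * L)%N & (max_comm e P X w <= 2 * L)%N].
Proof.
have [enc [dec [size_enc encK]]] := bit_code.
(* By round [start u] all the children of u have finished sending. *)
pose start u := ((D - dep u) * L)%N.
pose got (rcv : V -> chan_log) (v c : V) : option Msg :=
  if child c v then dec (pmap id (rcv c)) else None.
pose P := Protocol (D.+1 * L)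
  (fun u v (_ : r.-tuple bool) (luv _ : chan_log) =>
     [&& u != root, v == par u & (start u <= size luv < start u + L)%N])
  (fun u v x (w : r.-tuple bool) rcv =>
     nth false (enc (step w u x (got rcv u))) (size (rcv u) - start u))
  (fun x w rcv => out w x (got rcv root)).
exists P => X w msg msgE.
have size_logs t u v : size (logs e P X w t u v) = t.
  by elim: t u v => //= t IH u v; rewrite size_rcons IH.
pose sent t u v := if (u != root) && (v == par u) then take (t - start u) (enc (msg u)) else [::].
have got_logs t v : (forall u v, pmap id (logs e P X w t u v) = sent t u v) ->
    (forall c, child c v -> start c + L <= t)%N ->
    got (fun z => logs e P X w t z v) v = from_children msg v.
  move=> H le; apply/funext => c; rewrite /got /from_children; case: ifP => // cv.
  rewrite H /sent; case/andP: (cv) => -> /eqP ->; rewrite eqxx /=.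
  rewrite take_oversize ?encK// size_enc; have := le _ cv; lia.
have logsE t u v : pmap id (logs e P X w t u v) = sent t u v.
  elim: t u v => [|t IH] u v /=; first by rewrite /sent sub0n take0 if_same.
  rewrite -cats1 pmap_cat IH size_logs /sent.
  have [ur|ur] := boolP (u != root); last by rewrite andbF.
  have [->|vp] := eqVneq v (par u); last by rewrite /= !andbF.
  rewrite e_par//=; case: ifP => [/andP[st lt]|nlt] /=.
    rewrite size_logs got_logs//.
      rewrite -msgE subSn// (take_nth false) ?cats1// size_enc; lia.
    move=> c /child_dep dc; apply: leq_trans st; rewrite /start dc.
    have := depD c; rewrite dc => dD.
    have -> : (D - dep u = (D - (dep u).+1).+1)%N by lia.
    by rewrite mulSn addnC.
  rewrite cats0; move/negbT: nlt; rewrite negb_and -ltnNge -leqNgt => /orP[lt|le].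
    by congr take; lia.
  by rewrite !take_oversize// size_enc; lia.
have bits_le u v : (bits_sent e P X w u v <= if v == par u then L else 0)%N.
  rewrite /bits_sent -size_pmap logsE /sent; case: (v == par u); last by rewrite andbF.
  rewrite andbT; case: ifP => // _.
  by rewrite size_take_min size_enc geq_minr.
split.
- rewrite /result /= got_logs// => c /child_dep dc.
  by have := depD c; rewrite /start dc => ?; nia.
- rewrite /total_comm -sum_nat_const; apply: leq_sum => u _.
  apply: (@leq_trans (\sum_(v : V) if v == par u then L else 0)%N).
    by apply: leq_sum => v _; exact: bits_le.
  by rewrite -big_mkcond/= big_pred1_eq.
apply/bigmax_leqP => u _; apply/bigmax_leqP => v _.
rewrite mul2n -addnn leq_add//; apply: leq_trans (bits_le _ _) _; by case: ifP.
Qed.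

End Protocol.
End Tree.

(** * Unbiased floating-point rounding *)

Section Rounding.

Lemma hermite (Q : nat) (z : int) : (0 < Q)%N ->
  \sum_(0 <= u < Q) ((z + u%:Z) %/ Q)%Z = z.
Proof.
move=> Q0.
pose g (y : int) := \sum_(0 <= u < Q) ((y + u%:Z) %/ Q)%Z.
have gS y : g (y + 1) = g y + 1.
  apply/eqP; rewrite -subr_eq0 opprD addrA -[g _ - g _]sumrB.
  rewrite (eq_big_nat _ _ (F2 := fun u => ((y + u.+1%:Z) %/ Q)%Z - ((y + u%:Z) %/ Q)%Z)).
    rewrite telescope_sumr//= addr0 divzDr ?dvdzz// divzz eqz_nat -lt0n Q0 /=.
    by apply/eqP; lia.
  by move=> u _; rewrite -[u.+1]add1n PoszD addrA.
have g0 : g 0 = 0.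
  by apply: big1_seq => u /=; rewrite mem_index_iota add0r => /andP[_ uQ]; rewrite divz_nat divn_small.
suff : forall y, g y = y by apply.
elim/int_rect => [|n IH|n IH]; [by rewrite g0| |]; first by rewrite -[n.+1]addn1 PoszD gS IH.
have := gS (- n.+1%:Z); rewrite -[n.+1]addn1 PoszD opprD addrNK IH => H.
by move: H; set a := g _; lia.
Qed.

Lemma sum_modn (M : zmodType) (a Q : nat) (f : nat -> M) :
  \sum_(0 <= u < a * Q) f (u %% Q)%N = (\sum_(0 <= u < Q) f u) *+ a.
Proof.
elim: a => [|a IH]; first by rewrite mul0n big_nil mulr0n.
rewrite mulSn addnC (@big_cat_nat _ _ _ (a * Q)) ?leq_addr//= IH mulrSr; congr (_ + _).
rewrite -{1}[(a * Q)%N]add0n big_addn addnC addnK; apply: eq_big_nat => u /andP[_ uQ].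
by rewrite addnC modnMDl modn_small.
Qed.

Variables (q N : nat).

(* Exponent, and mantissa shifted by 2 ^ q to make it nonnegative. *)
Definition float : finType := ('I_N.+1 * 'I_(2 * 2 ^ q).+1)%type.

Definition float_val (x : float) : int := (x.2%:Z - (2 ^ q)%:Z) * (2 ^ x.1)%:Z.

Definition float_exp (z : int) : nat := (up_log 2 `|z|.+1 - q)%N.

Definition mantissa (z : int) (u : nat) : int :=
  ((z + (u %% 2 ^ float_exp z)%N%:Z) %/ (2 ^ float_exp z)%N)%Z.

Definition float_round (z : int) (u : nat) : float :=
  (inord (float_exp z), inord `|mantissa z u + (2 ^ q)%:Z|).

Lemma absz_lt_float z : (`|z| < 2 ^ (q + float_exp z))%N.
Proof.
apply: leq_trans (up_logP _ (isT : 1 < 2)%N) _; rewrite leq_exp2l// /float_exp; lia.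
Qed.

Lemma mantissa_bound z u : (`|mantissa z u| <= 2 ^ q)%N.
Proof.
have := absz_lt_float z; rewrite expnD /mantissa; set Q := (2 ^ float_exp z)%N => H.
have Q0 : (0 < Q)%N by rewrite expn_gt0.
have uQ : (u %% Q < Q)%N by rewrite ltn_pmod.
have E := divz_eq (z + (u %% Q)%N%:Z) Q.
have M0 : 0 <= ((z + (u %% Q)%N%:Z) %% Q)%Z by apply: modz_ge0; lia.
have M1 : ((z + (u %% Q)%N%:Z) %% Q)%Z < Q%:Z by apply: ltz_pmod; lia.
move: E M0 M1; set m := (_ %/ _)%Z; set r := (_ %% _)%Z; set v := (u %% Q)%N in uQ *.
move=> E M0 M1; rewrite leqNgt; apply/negP => lt.
have [m0|m0] := lerP 0 m.
  have : ((2 ^ q)%:Z + 1) * Q%:Z <= m * Q%:Z by rewrite ler_wpM2r//; lia.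
  nia.
have : m * Q%:Z <= - ((2 ^ q)%:Z + 1) * Q%:Z by rewrite ler_wpM2r//; lia.
nia.
Qed.

Section InRange.
Variable z : int.
Hypothesis zN : (`|z| < 2 ^ (q + N))%N.

Lemma float_exp_le : (float_exp z <= N)%N.
Proof. by rewrite leq_subLR up_log_min. Qed.

Lemma float_roundK u : float_val (float_round z u) = mantissa z u * (2 ^ float_exp z)%:Z.
Proof.
have := mantissa_bound z u => H.
rewrite /float_val /float_round /= !inordK ?ltnS ?float_exp_le//; last by lia.
by congr (_ * _); lia.
Qed.

Lemma float_err u : `|float_val (float_round z u) - z| * (2 ^ q)%:Z <= 2 * `|z|.
Proof.
rewrite float_roundK.
have [e0|e0] := posnP (float_exp z).
  by rewrite /mantissa e0 expn0 modn1 addr0 divz1 mulr1 subrr normr0 mul0r mulr_ge0.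
have U : (2 ^ (q + float_exp z) <= 2 * `|z|)%N.
  have : (2 ^ (up_log 2 `|z|.+1).-1 < `|z|.+1)%N.
    apply: up_log_gtn => //; case: (posnP `|z|%N) => [z0|//].
    by move: e0; rewrite /float_exp z0 up_log1.
  move=> H; have -> : (q + float_exp z = (up_log 2 `|z|.+1).-1.+1)%N.
    by rewrite /float_exp in e0 *; lia.
  by rewrite expnS; lia.
move: U; rewrite /mantissa expnD; set Q := (2 ^ float_exp z)%N => U.
have Q0 : (0 < Q)%N by rewrite expn_gt0.
have uQ : (u %% Q < Q)%N by rewrite ltn_pmod.
have E := divz_eq (z + (u %% Q)%N%:Z) Q.
have M0 : 0 <= ((z + (u %% Q)%N%:Z) %% Q)%Z by apply: modz_ge0; lia.
have M1 : ((z + (u %% Q)%N%:Z) %% Q)%Z < Q%:Z by apply: ltz_pmod; lia.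
move: E M0 M1; set m := (_ %/ _)%Z; set r := (_ %% _)%Z; set v := (u %% Q)%N in uQ *.
move=> E M0 M1.
have : `|m * Q%:Z - z| <= Q%:Z by lia.
move=> B; apply: (@le_trans _ _ (Q%:Z * (2 ^ q)%:Z)); first by rewrite ler_wpM2r.
lia.
Qed.

Lemma float_mean : \sum_(u < 2 ^ N) (float_val (float_round z u) - z) = 0.
Proof.
rewrite sumrB sumr_const card_ord; apply/eqP; rewrite subr_eq0; apply/eqP.
under eq_bigr do rewrite float_roundK.
rewrite -mulr_suml -(big_mkord xpredT (fun u => mantissa z u)) /mantissa.
have -> : (2 ^ N = 2 ^ (N - float_exp z) * 2 ^ float_exp z)%N.
  by rewrite -expnD subnK// float_exp_le.
rewrite (@sum_modn _ _ _ (fun v => (z + v%:Z) %/ (2 ^ float_exp z)%N)%Z).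
by rewrite hermite ?expn_gt0// mulrnA -[RHS]mulr_natr natz.
Qed.

End InRange.
End Rounding.

(** * Count sketches *)

Section Sketch.
Variables (n t beta : nat).
Definition hash : Type := 'I_t -> 'I_n -> bool * 'I_(2 ^ beta).
Notation counter := ('I_t * 'I_(2 ^ beta))%type.

Definition sgn (h : hash) j i : int := (-1) ^+ (h j i).1.

Definition sketch (h : hash) (y : 'I_n -> nat) (b : counter) : int :=
  \sum_(i | (h b.1 i).2 == b.2) sgn h b.1 i * (y i)%:Z.

Lemma sketchD h y y' b : sketch h (fun i => y i + y' i)%N b = sketch h y b + sketch h y' b.
Proof. by rewrite -big_split; apply: eq_bigr => i _; rewrite PoszD mulrDr. Qed.

Lemma sketch_sum h (J : finType) (P : pred J) (g : J -> 'I_n -> nat) b :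
  sketch h (fun i => \sum_(c | P c) g c i)%N b = \sum_(c | P c) sketch h (g c) b.
Proof.
rewrite /sketch exchange_big/=; apply: eq_bigr => i _.
by rewrite -mulr_sumr; congr (_ * _); rewrite -natz natr_sum; apply: eq_bigr => c _; rewrite natz.
Qed.

Variables (k Bd q N : nat) (i0 : 'I_n).

Definition sparse_list : finType := {ffun 'I_k -> 'I_n * 'I_Bd.+1}.

Definition heavy (H : sparse_list) (i : 'I_n) : nat := (\sum_(j | (H j).1 == i) (H j).2)%N.

Lemma heavy_restrict (T : {set 'I_n}) (y : 'I_n -> nat) : (#|T| <= k)%N ->
  (forall i, y i <= Bd)%N -> exists H, forall i, heavy H i = if i \in T then y i else 0%N.
Proof.
move=> Tk yB; pose l := nth i0 (enum T).
exists [ffun j : 'I_k => (l j, inord (if (j < #|T|)%N then y (l j) else 0%N))] => i.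
rewrite /heavy; have [iT|iT] := boolP (i \in T); last first.
  apply: big1 => j; rewrite !ffunE /= => /eqP lj.
  rewrite inordK; last by case: ifP => // _; rewrite ltnS.
  case: ifP => // jT; case/negP: iT; rewrite -lj /l -mem_enum mem_nth//.
  by rewrite -cardE.
have jk : (index i (enum T) < #|T|)%N by rewrite cardE index_mem mem_enum.
pose j0 := Ordinal (leq_trans jk Tk).
have lj0 : l j0 = i by rewrite /l nth_index// mem_enum.
rewrite (bigD1 j0) ?ffunE ?lj0//= big1 ?addn0 ?ffunE/=.
  by rewrite jk inordK ?lj0 // ltnS.
move=> j /andP[]; rewrite !ffunE /= => /eqP lj jj0.
rewrite inordK; last by case: ifP => // _; rewrite ltnS.
case: ifP => // jT; case/eqP: jj0; apply: val_inj => /=.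
by rewrite -lj /l index_uniq ?enum_uniq// -cardE.
Qed.

Definition msg : finType := (sparse_list * {ffun counter -> float q N})%type.

Definition aggregate (V : finType) (h : hash) (x : 'rV[nat]_n) (rcv : V -> option msg)
    (b : counter) : int :=
  sketch h (x ord0) b +
  \sum_c (if rcv c is Some m then sketch h (heavy m.1) b + float_val (m.2 b) else 0).

Definition residual (h : hash) (F : counter -> int) (H : sparse_list) b : int :=
  F b - sketch h (heavy H) b.

Definition best_list (h : hash) (F : counter -> int) : sparse_list :=
  [arg min_(H < [ffun=> (i0, ord0)]) (\max_b `|residual h F H b|)%N].

Lemma best_listP h F H b :
  (`|residual h F (best_list h F) b| <= \max_b' `|residual h F H b'|)%N.
Proof.
rewrite /best_list; case: arg_minnP => // H' _ /(_ H isT); apply: leq_trans.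
by rewrite (bigD1 b)//= leq_maxl.
Qed.

Definition compress (h : hash) (dither : counter -> nat) (F : counter -> int) : msg :=
  let H := best_list h F in
  (H, [ffun b => float_round q N (residual h F H b) (dither b)]).

(* The estimate is the value around which some strict majority of the rows is
   most concentrated; it plays the role of the median in CountSketch. *)
Definition decode (h : hash) (F : counter -> int) (i : 'I_n) : nat :=
  [arg min_(p < (ord0 : 'I_Bd.+1, [set: 'I_t]) | (t < 2 * #|p.2|)%N)
     (\max_(j in p.2) `|(sgn h j i * F (j, (h j i).2) - p.1%:Z)%R|)%N].1.

Lemma bigmax_real_le (R : realType) (J : finType) (P : pred J) (f : J -> nat) (a : R) :
  0 <= a -> (forall j, P j -> (f j)%:R <= a) -> (\max_(j | P j) f j)%:R <= a.
Proof.
move=> a0 fa; elim/big_ind: _ => // x y xa ya.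
by rewrite /maxn; case: ifP.
Qed.

Lemma decodeP (R : realType) h F i (y : nat) (G : {set 'I_t}) (a : R) : (0 < t)%N ->
  (y <= Bd)%N -> (t < 2 * #|G|)%N -> 0 <= a ->
  (forall j, j \in G -> `|sgn h j i * F (j, (h j i).2) - y%:Z|%:~R <= a) ->
  `|(decode h F i)%:R - y%:R| <= 2 * a.
Proof.
move=> t0 yB Gt a0 Ga; rewrite /decode.
case: arg_minnP => /= [|[x J] /= Jt]; first by rewrite cardsT card_ord; lia.
move=> /(_ (inord y, G) Gt) /=; rewrite inordK ?ltnS// => le.
have {}Ga : (\max_(j in G) `|(sgn h j i * F (j, (h j i).2) - y%:Z)%R|)%N%:R <= a.
  apply: bigmax_real_le => // j /Ga; by rewrite -natr_absz -pmulrn.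
have [j jJG] : exists j, j \in J :&: G.
  apply/set0Pn; rewrite -card_gt0.
  have : (#|J :|: G| <= t)%N by rewrite -[X in (_ <= X)%N](card_ord t) max_card.
  move=> U; have UI := cardsUI J G; rewrite lt0n; apply/negP => /eqP I0.
  rewrite I0 addn0 in UI; rewrite UI in U.
  move: Jt Gt U; set a1 := #|J|; set a2 := #|G|; lia.
move: jJG; rewrite inE => /andP[jJ jG].
set m := sgn h j i * F (j, (h j i).2).
have b1 : `|m - x%:Z|%N%:R <= a.
  apply: le_trans Ga; rewrite ler_nat; apply: leq_trans le.
  by rewrite (bigD1 j)//= leq_maxl.
have b2 : `|m - y%:Z|%N%:R <= a.
  by apply: le_trans Ga; rewrite ler_nat (bigD1 j)//= leq_maxl.
apply: (@le_trans _ _ (`|m - x%:Z|%N + `|m - y%:Z|%N)%N%:R); last by rewrite natrD; lra.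
rewrite -[x%:R]/((x%:Z)%:~R) -[y%:R]/((y%:Z)%:~R) -intrB -intr_norm.
rewrite -[leRHS]/(Posz _)%:~R ler_int; lia.
Qed.

End Sketch.

(** * Error analysis *)

Section Analysis.
Variables (R : realType) (V : finType) (root : V) (par : V -> V) (dep : V -> nat) (D : nat).
Hypothesis dep0 : forall v, (dep v == 0) = (v == root).
Hypothesis depS : forall v, v != root -> dep v = (dep (par v)).+1.
Hypothesis depD : forall v, (dep v <= D)%N.
Variables (n t beta k Bd q N : nat) (i0 : 'I_n).

Notation counter := ('I_t * 'I_(2 ^ beta))%type.
Definition coord : finType := ('I_t * 'I_n + V * counter)%type.
Definition coin : finType := (bool * 'I_(2 ^ beta) * 'I_(2 ^ N))%type.
Notation Omega := {ffun coord -> coin}.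

Definition hash_of (w : Omega) : hash n t beta := fun j i => (w (inl (j, i))).1.
Definition dither_of (w : Omega) (v : V) (b : counter) : nat := (w (inr (v, b))).2.

Definition node_step (w : Omega) (v : V) (x : 'rV[nat]_n)
    (rcv : V -> option (msg n t beta k Bd q N)) : msg n t beta k Bd q N :=
  compress k Bd q N i0 (hash_of w) (dither_of w v) (aggregate (hash_of w) x rcv).

Definition root_output (w : Omega) (x : 'rV[nat]_n)
    (rcv : V -> option (msg n t beta k Bd q N)) : 'rV[R]_n :=
  \row_i (decode Bd (hash_of w) (aggregate (hash_of w) x rcv) i)%:R.

Variable X : V -> 'rV[nat]_n.

Definition msg_of (w : Omega) : V -> msg n t beta k Bd q N :=
  message root par dep D (node_step w) X.

Definition received (w : Omega) (v : V) : counter -> int :=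
  aggregate (hash_of w) (X v) (from_children root par (msg_of w) v).

Definition rest (w : Omega) (v : V) : counter -> int :=
  residual (hash_of w) (received w v) (best_list k Bd i0 (hash_of w) (received w v)).

Definition delta (w : Omega) (v : V) (b : counter) : int :=
  float_val (float_round q N (rest w v b) (dither_of w v b)) - rest w v b.

Lemma msg_ofE w v : msg_of w v =
  (best_list k Bd i0 (hash_of w) (received w v),
   [ffun b => float_round q N (rest w v b) (dither_of w v b)]).
Proof. by rewrite /msg_of messageE. Qed.

Definition subsum (v : V) (i : 'I_n) : nat := (\sum_(u | sub par dep u v) X u ord0 i)%N.

Definition err (w : Omega) (v : V) (b : counter) : int :=
  received w v b - sketch (hash_of w) (subsum v) b.

Lemma errE w v b :
  err w v b = \sum_(u | sub par dep u v && (u != v)) delta w u b.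
Proof.
elim/(depth_ind depD): v b => v IH b.
have eS : subsum v = (fun i => X v ord0 i + \sum_(c | child root par c v) subsum c i)%N.
  by apply/funext => i; rewrite /subsum (sum_sub dep0 depS).
rewrite (sum_strict_sub dep0 depS) /err eS sketchD sketch_sum {1}/received /aggregate.
have -> (x y z : int) : x + y - (x + z) = y - z by rewrite opprD addrACA subrr add0r.
rewrite [X in _ - X]big_mkcond -sumrB [RHS]big_mkcond/=; apply: eq_bigr => c _.
rewrite /from_children; case: ifP => cv; last by rewrite subr0.
rewrite msg_ofE /= ffunE (bigD1 c) ?sub_refl//=.
rewrite -IH ?(child_dep depS cv)// /delta /err.
have : rest w c b = received w c b -
  sketch (hash_of w) (heavy (best_list k Bd i0 (hash_of w) (received w c))) b by [].
set fv := float_val _; set r := rest w c b; set a := received w c b.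
set s1 := sketch _ (heavy _) b; set s2 := sketch _ _ b; move=> ->.
ring.
Qed.

Section Restrict.
Variable T : {set 'I_n}.
Hypothesis Tk : (#|T| <= k)%N.
Hypothesis subsumB : forall v i, (subsum v i <= Bd)%N.

Definition tail_sum (v : V) (i : 'I_n) : nat := if i \in T then 0%N else subsum v i.

Lemma rest_le w v b :
  (`|rest w v b| <= \max_b' `|(sketch (hash_of w) (tail_sum v) b' + err w v b')%R|)%N.
Proof.
have [H HE] := heavy_restrict i0 Tk (subsumB v).
apply: leq_trans (best_listP _ _ _ H _) _; apply/bigmax_leqP => b' _.
rewrite (bigD1 b')//=; apply: leq_trans (leq_maxl _ _).
rewrite /residual /err.
have -> : subsum v = (fun i => heavy H i + tail_sum v i)%N.
  by apply/funext => i; rewrite HE /tail_sum; case: ifP; rewrite ?addn0.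
rewrite (sketchD _ (heavy H) (tail_sum v)); apply: eq_leq; congr absz; ring.
Qed.

Definition tau2 (v : V) : nat := (\sum_i tail_sum v i ^ 2)%N.
Definition tau (v : V) : R := Num.sqrt (tau2 v)%:R.

Lemma sum_sqrn_le (J : finType) (P : pred J) (f : J -> nat) :
  (\sum_(j | P j) f j ^ 2 <= (\sum_(j | P j) f j) ^ 2)%N.
Proof. by elim/big_rec2: _ => // j x y _ H; nia. Qed.

Lemma tau2_children v : (\sum_(c | child root par c v) tau2 c <= tau2 v)%N.
Proof.
rewrite exchange_big/=; apply: leq_sum => i _; apply: leq_trans (sum_sqrn_le _ _) _.
rewrite leq_exp2r// /tail_sum; case: (i \in T); first by rewrite big1.
by rewrite /subsum (sum_sub dep0 depS) leq_addl.
Qed.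

Lemma tau2_sub v : (\sum_(u | sub par dep u v) tau2 u <= D.+1 * tau2 v)%N.
Proof.
suff : (\sum_(u | sub par dep u v) tau2 u <= (D - dep v).+1 * tau2 v)%N.
  by move/leq_trans; apply; rewrite leq_mul2r ltnS leq_subr orbT.
elim/(depth_ind depD): v => v IH.
rewrite (sum_sub dep0 depS) mulSn leq_add2l.
apply: (@leq_trans (\sum_(c | child root par c v) (D - dep v) * tau2 c)%N).
  apply: leq_sum => c cv; have dc := child_dep depS cv.
  apply: leq_trans (IH c _) _; first by rewrite dc.
  by rewrite leq_mul2r; have := depD c; rewrite dc; lia.
by rewrite -big_distrr leq_mul2l tau2_children orbT.
Qed.

Lemma tau_ge0 v : 0 <= tau v. Proof. exact: sqrtr_ge0. Qed.

Lemma sqr_tau v : tau v ^+ 2 = (tau2 v)%:R.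
Proof. by rewrite sqr_sqrtr ?ler0n. Qed.

Lemma tau_le v : tau v <= (n * Bd)%:R.
Proof.
rewrite -[leRHS]ger0_norm// -sqrtr_sqr ler_sqrt ?sqr_ge0// -natrX ler_nat.
apply: leq_trans (sum_sqrn_le _ _) _; rewrite leq_exp2r//.
rewrite -[X in (X * _)%N](card_ord n) -sum_nat_const; apply: leq_sum => i _.
by rewrite /tail_sum; case: ifP.
Qed.

Variable s : R.
Hypothesis s1 : 1 <= s.
Hypothesis sN : 2 * s * (n * Bd)%:R < (2 ^ N)%:R.

(* Truncated so that the bound of [delta'_le] holds for every outcome, as the
   martingale estimate requires; it equals [delta] on the good event. *)
Definition delta' (w : Omega) (v : V) (b : counter) : int :=
  if `|rest w v b|%:~R <= 2 * s * tau v then delta w v b else 0.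

Lemma rest_in_range v (z : int) : `|z|%:~R <= 2 * s * tau v -> (`|z| < 2 ^ (q + N))%N.
Proof.
move=> H; rewrite -(ltr_nat R) natr_absz; apply: le_lt_trans H _.
apply: (@le_lt_trans _ _ (2 * s * (n * Bd)%:R)).
  by rewrite ler_wpM2l ?tau_le//; move: s1; lra.
by apply: lt_le_trans sN _; rewrite ler_nat leq_exp2l// leq_addl.
Qed.

Lemma delta'_le w v b : `|(delta' w v b)%:~R : R| <= 4 * s / (2 ^ q)%:R * tau v.
Proof.
have q0 : 0 < (2 ^ q)%:R :> R by rewrite ltr0n expn_gt0.
rewrite /delta'; case: ifP => [H|_]; last first.
  by rewrite normr0 mulr_ge0 ?tau_ge0// divr_ge0 ?(ltW q0)//; move: s1; lra.
have := float_err (rest_in_range H) (dither_of w v b).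
rewrite -/(delta w v b) -(ler_int R) !intrM -!intr_norm => E.
rewrite mulrAC ler_pdivlMr//; apply: le_trans E _.
move: H; lra.
Qed.

Definition rho : R := 4 * s * D.+1%:R / (2 ^ q)%:R.

Definition good_sketch (w : Omega) := forall v b,
  `|(sketch (hash_of w) (tail_sum v) b)%:~R : R| <= s * tau v.

Definition good_rounding (w : Omega) := forall v b,
  `|\sum_(u | sub par dep u v && (u != v)) (delta' w u b)%:~R : R| <= s * (rho * tau v).

Lemma good_err w : rho <= 1 -> good_sketch w -> good_rounding w ->
  forall v b, `|(err w v b)%:~R : R| <= s * (rho * tau v).
Proof.
move=> rho1 gs gr.
have H v : (forall u, (dep v < dep u)%N -> forall b, `|rest w u b|%:~R <= 2 * s * tau u) ->
    forall b, `|(err w v b)%:~R : R| <= s * (rho * tau v).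
  move=> IH b; rewrite errE rmorph_sum/=; apply: le_trans (gr v b).
  rewrite le_eqVlt; apply/orP; left; apply/eqP; congr (`|_|).
  apply: eq_bigr => u /andP[uv uneq]; rewrite /delta' IH//.
  exact: sub_dep uv uneq.
suff K v : forall b, `|rest w v b|%:~R <= 2 * s * tau v by move=> v b; apply: H.
elim/(depth_ind depD): v => v IH b.
have tv := tau_ge0 v.
rewrite -natr_absz; apply: le_trans (_ : (\max_b' `|(sketch (hash_of w) (tail_sum v) b' + err w v b')%R|)%N%:R <= _).
  by rewrite ler_nat; exact: rest_le.
apply: bigmax_real_le => [|b' _]; first by rewrite mulr_ge0//; move: s1; lra.
rewrite natr_absz intr_norm intrD.
apply: le_trans (ler_normD _ _) _.
have : s * (rho * tau v) <= s * tau v.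
  by rewrite ler_wpM2l ?ler_piMl//; move: s1; lra.
have := gs v b'; have := H v IH b'; move: s1; lra.
Qed.

Lemma coin_gt0 : (0 < #|coin|)%N.
Proof. by rewrite /coin !card_prod card_bool !card_ord !muln_gt0 !expn_gt0. Qed.

Lemma avg_sign (f : coin -> R) :
  (forall c, f ((~~ c.1.1, c.1.2), c.2) = - f c) -> avg f = 0.
Proof.
move=> fN; pose flip (c : coin) : coin := ((~~ c.1.1, c.1.2), c.2).
have flipK : involutive flip by move=> [[c1 c2] c3]; rewrite /flip /= negbK.
have : avg f = - avg f.
  rewrite {1}/avg (reindex_inj (inv_inj flipK))/= (eq_bigr _ (fun c _ => fN c)).
  by rewrite sumrN mulNr.
by move/eqP; rewrite -subr_eq0 opprK -mulr2n mulrn_eq0/= => /eqP.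
Qed.

Definition hashed_sign (w : Omega) (j : 'I_t) (b : 'I_(2 ^ beta)) (i : 'I_n) : int :=
  if (hash_of w j i).2 == b then sgn (hash_of w) j i else 0.

Lemma hashed_sign_splice x w j b i (A : {set coord}) :
  hashed_sign (splice A x w) j b i = if inl (j, i) \in A then hashed_sign x j b i else hashed_sign w j b i.
Proof. by rewrite /hashed_sign /sgn /hash_of ffunE; case: (_ \in A). Qed.

Lemma hashed_sign_norm w j b i : `|(hashed_sign w j b i)%:~R : R| = ((hash_of w j i).2 == b)%:R.
Proof.
by rewrite /hashed_sign; case: ifP => _; rewrite ?normr0// /sgn rmorphXn/= rmorphN1 normrX normrN1 expr1n.
Qed.

Lemma avg_hashed_sign j b i (a : R) (A : {set coord}) w : inl (j, i) \in A ->
  avg (fun x => (hashed_sign (splice A x w) j b i)%:~R * a) = 0.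
Proof.
move=> iA.
pose f (c : coin) : R := (if c.1.2 == b then (-1) ^+ c.1.1 else 0 : int)%:~R * a.
rewrite (eq_avg (g := fun x : Omega => f (x (inl (j, i))))).
  rewrite avg_marginal ?coin_gt0//; apply: avg_sign => c; rewrite /f /=.
  case: ifP; rewrite ?mul0r ?oppr0// => _.
  by rewrite -mulNr; congr (_ * _); case: c.1.1; rewrite /= ?expr0 ?expr1 ?rmorphN1 ?opprK.
by move=> x; rewrite hashed_sign_splice iA.
Qed.

Lemma sketch_tail_sum w v b : (sketch (hash_of w) (tail_sum v) b)%:~R =
  \sum_(i in ~: T) (hashed_sign w b.1 b.2 i)%:~R * (subsum v i)%:R :> R.
Proof.
rewrite /sketch rmorph_sum/= big_mkcond [RHS]big_mkcond; apply: eq_bigr => i _.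
rewrite inE /hashed_sign /tail_sum; case: (i \in T) => /=; first by rewrite mulr0 if_same.
by case: ifP; rewrite ?mul0r// rmorphM.
Qed.

Lemma tau2E v : (tau2 v)%:R = \sum_(i in ~: T) (subsum v i)%:R ^+ 2 :> R.
Proof.
rewrite natr_sum [RHS]big_mkcond; apply: eq_bigr => i _.
by rewrite natrX inE /tail_sum; case: (i \in T); rewrite //= expr0n.
Qed.

Lemma prob_sketch_bad v b :
  prob R [pred w : Omega | s * tau v < `|(sketch (hash_of w) (tail_sum v) b)%:~R|]
    <= 2 * expR (- (s ^+ 2 / 8)).
Proof.
have s0 : 0 <= s by move: s1; lra.
have := @prob_norm_sum_gt R _ _ coin_gt0 _ (~: T) (fun i => [set (inl (b.1, i) : coord)])
  (fun=> 0%N) (fun i w => (hashed_sign w b.1 b.2 i)%:~R * (subsum v i)%:R)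
  (fun i => (subsum v i)%:R) (tau v) s.
move=> H; apply: le_trans (H _ _ _ _ _ s0).
- by apply: prob_sub => w /=; rewrite sketch_tail_sum.
- move=> i i' x w _ _ ii' _ /=; rewrite hashed_sign_splice inE.
  by case: eqP => // -[] /eqP; rewrite (negPf ii').
- by move=> i w _; apply: avg_hashed_sign; rewrite inE.
- move=> i w _; rewrite normrM hashed_sign_norm normr_nat.
  by case: (_ == _); rewrite ?mul1r ?mul0r.
- exact: tau_ge0.
by rewrite sqr_tau tau2E.
Qed.

Lemma received_local (w w' : Omega) v : hash_of w = hash_of w' ->
  (forall u b, (dep v < dep u)%N -> dither_of w u b = dither_of w' u b) ->
  received w v = received w' v.
Proof.
elim/(depth_ind depD): v => v IH hw dw.
rewrite /received hw.
have E : from_children root par (msg_of w) v = from_children root par (msg_of w') v; last first.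
  exact: (f_equal (aggregate (hash_of w') (X v)) E).
apply/funext => c; rewrite /from_children.
have [cv|_] := boolP (child root par c v); last by [].
have vc : (dep v < dep c)%N by rewrite (child_dep depS cv).
rewrite !msg_ofE /rest (IH c vc hw); last by move=> u b cu; apply: dw; apply: ltn_trans cu.
by rewrite hw; congr (Some (_, _)); apply/ffunP => b; rewrite !ffunE dw.
Qed.

Lemma prob_rounding_bad v b :
  prob R [pred w : Omega | s * (rho * tau v) <
      `|\sum_(u | sub par dep u v && (u != v)) (delta' w u b)%:~R|]
    <= 2 * expR (- (s ^+ 2 / 8)).
Proof.
have s0 : 0 <= s by move: s1; lra.
have q0 : 0 < (2 ^ q)%:R :> R by rewrite ltr0n expn_gt0.
pose A u : {set coord} := [set inr (u, b)].
have hA u x w : hash_of (splice (A u) x w) = hash_of w.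
  by apply/funext => j; apply/funext => i; rewrite /hash_of ffunE inE.
have dA u x w u' b' : u' != u -> dither_of (splice (A u) x w) u' b' = dither_of w u' b'.
  by move=> uu; rewrite /dither_of ffunE inE; case: eqP => // -[] /eqP; rewrite (negPf uu).
have rA u u' x w b' : (dep u' <= dep u)%N -> rest (splice (A u') x w) u b' = rest w u b'.
  move=> le; rewrite /rest hA (received_local (w' := w))// => u1 b1 lt.
  by apply: dA; apply: contraTneq lt => ->; rewrite -leqNgt.
have := @prob_norm_sum_gt R _ _ coin_gt0 _ [set u | sub par dep u v && (u != v)] A
  dep (fun u w => (delta' w u b)%:~R)
  (fun u => 4 * s / (2 ^ q)%:R * tau u) (rho * tau v) s.
move=> H; apply: le_trans (H _ _ _ _ _ s0).
- by apply: prob_sub => w /=; congr (_ < `| _ |); apply: eq_bigl => u; rewrite inE.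
- by move=> u u' x w _ _ uu' le; rewrite /delta' /delta rA// dA.
- move=> u w _; pose z := rest w u b.
  pose f (c : coin) : R := (if `|z|%:~R <= 2 * s * tau u
     then float_val (float_round q N z c.2) - z else 0)%:~R.
  rewrite (eq_avg (g := fun x : Omega => f (x (inr (u, b))))); last first.
    by move=> x; rewrite /delta' /delta rA// /f -/z /dither_of ffunE inE eqxx.
  rewrite avg_marginal ?coin_gt0// /avg /f.
  have [zs|_] := boolP (`|z|%:~R <= 2 * s * tau u); last by rewrite big1 ?mul0r.
  rewrite -(pair_bigA _ (fun (_ : (bool * 'I_(2 ^ beta))%type) (c : 'I_(2 ^ N)) =>
    (float_val (float_round q N z c) - z)%:~R : R))/= big1 ?mul0r// => p _.
  by rewrite -rmorph_sum float_mean// (rest_in_range zs).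
- by move=> u w _; exact: delta'_le.
- by rewrite mulr_ge0 ?tau_ge0// /rho divr_ge0 ?(ltW q0)// mulr_ge0 ?ler0n// mulr_ge0.
rewrite exprMn sqr_tau.
under eq_bigr do rewrite exprMn sqr_tau.
rewrite -mulr_sumr -natr_sum.
apply: (@le_trans _ _ ((4 * s / (2 ^ q)%:R) ^+ 2 * (D.+1 * tau2 v)%:R)).
  rewrite ler_wpM2l ?sqr_ge0// ler_nat; apply: leq_trans (tau2_sub v).
  rewrite big_mkcond [leqRHS]big_mkcond/=; apply: leq_sum => u _.
  by rewrite inE; case: (sub _ _ _ _); case: (u != v).
have -> : rho = 4 * s / (2 ^ q)%:R * D.+1%:R by rewrite /rho mulrAC.
rewrite natrM mulrA ler_wpM2r// [leRHS]exprMn ler_wpM2l ?sqr_ge0//.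
by rewrite expr2 ler_peMl ?ler1n.
Qed.

Lemma hash_splice_ne x w j i l : l != i ->
  hash_of (splice [set (inl (j, l) : coord)] x w) j i = hash_of w j i.
Proof.
move=> li; rewrite /hash_of ffunE inE ifN//.
by apply: contraNneq li => -[->].
Qed.

Definition row_err (w : Omega) (j : 'I_t) (i : 'I_n) : int :=
  sgn (hash_of w) j i * sketch (hash_of w) (subsum root) (j, (hash_of w j i).2)
    - (subsum root i)%:Z.

Definition cross (w : Omega) (j : 'I_t) (i l : 'I_n) : R :=
  (sgn (hash_of w) j i)%:~R *
    ((hashed_sign w j (hash_of w j i).2 l)%:~R * (subsum root l)%:R).

Lemma row_errE w j i : (row_err w j i)%:~R = \sum_(l | l != i) cross w j i l.
Proof.
rewrite /row_err intrB rmorphM/= /sketch rmorph_sum/= (bigD1 i)//= mulrDr.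
rewrite -rmorphM/= mulrA -expr2 /sgn -exprM muln2 -addnn.
have -> (c : bool) : (-1) ^+ (c + c) = 1 :> int by case: c.
rewrite mul1r addrAC subrr add0r mulr_sumr big_mkcond [RHS]big_mkcond.
apply: eq_bigr => l _; rewrite /cross /hashed_sign /sgn andbC.
case: (l != i) => //=; case: ifP => _; last by rewrite mul0r mulr0.
by rewrite rmorphM.
Qed.

Definition collide (j : 'I_t) (i l : 'I_n) (w : Omega) : bool :=
  (hash_of w j l).2 == (hash_of w j i).2.

Lemma sqr_cross w j i l :
  cross w j i l ^+ 2 = (subsum root l)%:R ^+ 2 * (collide j i l w)%:R.
Proof.
rewrite -real_normK ?num_real// !normrM hashed_sign_norm normr_nat /sgn.
rewrite rmorphXn/= rmorphN1 normrX normrN1 expr1n mul1r exprMn mulrC; congr (_ * _).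
by rewrite -/(collide j i l w); case: (collide _ _ _ _); rewrite ?expr1n ?expr0n.
Qed.

Lemma avg_bucket (b : 'I_(2 ^ beta)) :
  avg (fun c : coin => (c.1.2 == b)%:R) = ((2 ^ beta)%:R)^-1 :> R.
Proof.
rewrite /avg -(pair_bigA _ (fun (p : (bool * 'I_(2 ^ beta))%type) (_ : 'I_(2 ^ N)) =>
  (p.2 == b)%:R : R))/=.
under eq_bigr do rewrite sumr_const card_ord.
rewrite -(pair_bigA _ (fun (_ : bool) (x : 'I_(2 ^ beta)) => (x == b)%:R *+ (2 ^ N) : R))/=.
rewrite (eq_bigr (fun=> (2 ^ N)%:R)) => [|c _]; last first.
  rewrite (bigD1 b)//= eqxx big1 ?addr0// => x /negPf ->; exact: mul0rn.
rewrite sumr_const card_bool /coin !card_prod card_bool !card_ord !natrM.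
have N0 : (2 ^ N)%:R != 0 :> R by rewrite pnatr_eq0 expn_eq0.
have b0 : (2 ^ beta)%:R != 0 :> R by rewrite pnatr_eq0 expn_eq0.
rewrite -[_ *+ 2]mulr_natr; move: N0 b0.
move: ((2 ^ N)%:R : R) ((2 ^ beta)%:R : R) => x y x0 y0.
by field; rewrite x0 y0.
Qed.

Lemma avg_collide j i l : l != i -> avg (fun w => (collide j i l w)%:R) = ((2 ^ beta)%:R)^-1 :> R.
Proof.
move=> li; rewrite -(avg_splice coin_gt0 [set (inl (j, l) : coord)]).
rewrite (eq_avg (g := fun=> ((2 ^ beta)%:R)^-1)) => [|w].
  by rewrite avg_const// card_Omega_gt0// coin_gt0.
rewrite -(avg_bucket (hash_of w j i).2).
rewrite -(avg_marginal coin_gt0 (inl (j, l) : coord)); apply: eq_avg => x.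
by rewrite /collide (hash_splice_ne x w j li) /hash_of ffunE inE eqxx.
Qed.

Hypothesis k0 : (0 < k)%N.
Hypothesis k_beta : (512 * k <= 2 ^ beta)%N.

Definition theta : R := tau root / (4 * Num.sqrt k%:R).

Lemma avg_sqr_cross j i :
  avg (fun w => (\sum_(l in ~: T :\ i) cross w j i l) ^+ 2) <= tau root ^+ 2 / (2 ^ beta)%:R.
Proof.
rewrite (avg_sqr_sum coin_gt0 (A := fun l => [set (inl (j, l) : coord)]) (rk := fun=> 0%N)
  (f := fun l w => cross w j i l)); first last.
- move=> l w; rewrite !inE => /andP[li _].
  rewrite (eq_avg (g := fun x => (sgn (hash_of w) j i)%:~R *
     ((hashed_sign (splice [set (inl (j, l) : coord)] x w) j (hash_of w j i).2 l)%:~R * (subsum root l)%:R))).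
    by rewrite avgZ avg_hashed_sign ?mulr0// inE.
  by move=> x; rewrite /cross /sgn hash_splice_ne.
- move=> l l' x w _; rewrite !inE => /andP[l'i _] ll' _.
  rewrite /cross /sgn hash_splice_ne// hashed_sign_splice inE ifN//.
  by apply: contraNneq ll' => -[->].
rewrite (eq_bigr (fun l => (subsum root l)%:R ^+ 2 / (2 ^ beta)%:R)) => [|l].
  rewrite -mulr_suml ler_wpM2r ?invr_ge0 ?ler0n// sqr_tau tau2E.
  rewrite [leRHS](bigID (fun l => l == i))/= addrC -[leLHS]addr0 lerD//; last first.
    by apply: sumr_ge0 => l _; exact: sqr_ge0.
  by rewrite le_eqVlt; apply/orP; left; apply/eqP; apply: eq_bigl => l; rewrite !inE andbC.
rewrite !inE => /andP[li _].
rewrite (eq_avg (g := fun w => (subsum root l)%:R ^+ 2 * (collide j i l w)%:R)).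
  by rewrite avgZ avg_collide.
by move=> w; exact: sqr_cross.
Qed.

Lemma prob_row_bad j i :
  prob R [pred w : Omega | theta < `|(row_err w j i)%:~R|] <= 16^-1.
Proof.
have b0 : 0 < (2 ^ beta)%:R :> R by rewrite ltr0n expn_gt0.
have kb : 512 * k%:R <= (2 ^ beta)%:R :> R by rewrite -natrM ler_nat.
have kR : 1 <= k%:R :> R by rewrite ler1n.
pose Y w := \sum_(l in ~: T :\ i) cross w j i l.
have split_bad (w : Omega) : theta < `|(row_err w j i)%:~R| ->
    [exists l, (l \in T :\ i) && collide j i l w] || (theta < `|Y w|).
  move=> bad; case: existsP => //= nc.
  suff <- : (row_err w j i)%:~R = Y w by [].
  rewrite row_errE /Y big_mkcond [RHS]big_mkcond; apply: eq_bigr => l _.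
  rewrite !inE; have [lT|lT] := boolP (l \in T); rewrite ?andbT// andbF.
  case: (eqVneq l i) => //= li.
  have : ~~ collide j i l w by apply/negP => cl; apply: nc; exists l; rewrite !inE li lT.
  by rewrite /collide /cross /hashed_sign => /negPf ->; rewrite mul0r mulr0.
apply: le_trans (prob_sub R split_bad) _.
apply: le_trans (prob_or R _ _) _.
apply: (@le_trans _ _ (512^-1 + 32^-1)); last lra.
apply: lerD.
  apply: le_trans (prob_exists R _) _.
  apply: (@le_trans _ _ (\sum_(l in T) ((2 ^ beta)%:R)^-1)).
    rewrite [leRHS]big_mkcond; apply: ler_sum => l _.
    have [lT|lT] := boolP (l \in T); last first.
      by rewrite prob_avg (eq_avg (g := fun=> 0)) ?avg_const ?card_Omega_gt0 ?coin_gt0// => w /=; rewrite !inE (negPf lT) andbF.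
    case: (eqVneq l i) => [->|li].
      by rewrite prob_avg (eq_avg (g := fun=> 0)) ?avg_const ?card_Omega_gt0 ?coin_gt0 ?invr_ge0 ?(ltW b0)// => w /=; rewrite !inE eqxx.
    by rewrite prob_avg -(avg_collide j li); apply: avg_le => w /=; rewrite !inE li lT.
  rewrite sumr_const -[_ *+ #|_|]mulr_natl ler_pdivrMr//.
  have : #|T|%:R <= k%:R :> R by rewrite ler_nat.
  lra.
have [t0|tn0] := eqVneq (tau root) 0.
  rewrite prob_avg (eq_avg (g := fun=> 0)) ?avg_const ?card_Omega_gt0 ?coin_gt0// => w /=.
  rewrite /theta t0 mul0r /Y big1 ?normr0 ?ltxx// => l; rewrite !inE => /andP[_ lT].
  have : (subsum root l)%:R ^+ 2 <= tau root ^+ 2 :> R.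
    by rewrite sqr_tau tau2E (bigD1 l) ?inE//= lerDl sumr_ge0// => ? _; exact: sqr_ge0.
  rewrite t0 expr0n /= => H; have /eqP : (subsum root l)%:R ^+ 2 == 0 :> R by rewrite eq_le H sqr_ge0.
  by move/eqP; rewrite sqrf_eq0 /cross => /eqP ->; rewrite !mulr0.
have tp : 0 < tau root by rewrite lt0r tn0 tau_ge0.
have th0 : 0 < theta by rewrite /theta divr_gt0// mulr_gt0// sqrtr_gt0; lra.
apply: (@le_trans _ _ (prob R [pred w | theta ^+ 2 <= Y w ^+ 2])).
  apply: prob_sub => w /= lt; rewrite -[leRHS]real_normK ?num_real//.
  by rewrite lerXn2r ?nnegrE ?(ltW th0) ?(ltW lt).
apply: le_trans (prob_markov (fun w => sqr_ge0 (Y w)) (exprn_gt0 2 th0)) _.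
rewrite ler_pdivrMr ?exprn_gt0//; apply: le_trans (avg_sqr_cross j i) _.
rewrite /theta expr_div_n exprMn (sqr_sqrtr (ler0n R k)) ler_pdivrMr//.
have -> : 32^-1 * (tau root ^+ 2 / (4 ^+ 2 * k%:R)) * (2 ^ beta)%:R =
   tau root ^+ 2 * ((2 ^ beta)%:R / (512 * k%:R)) by field; lra.
have k512 : 0 < 512 * k%:R :> R by rewrite mulr_gt0 ?ltr0n.
by rewrite ler_peMr ?sqr_ge0// ler_pdivlMr// mul1r.
Qed.

Definition good_rows (i : 'I_n) (w : Omega) : {set 'I_t} :=
  [set j | `|(row_err w j i)%:~R| <= theta].

Lemma row_err_local x w j i :
  row_err (splice [set (inl (j, i') : coord) | i' in 'I_n] x w) j i = row_err x j i.
Proof.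
have hx i' : hash_of (splice [set (inl (j, i') : coord) | i' in 'I_n] x w) j i' = hash_of x j i'.
  by rewrite /hash_of ffunE ifT//; apply: imset_f.
rewrite /row_err /sgn hx /sketch /=; congr (_ * _ - _).
by apply: eq_big => l; rewrite /sgn hx.
Qed.

Lemma prob_majority_bad i :
  prob R [pred w : Omega | (2 * #|good_rows i w| <= t)%N] <= ((2 ^ t)%:R)^-1.
Proof.
(* A bad majority forces 16 ^ #bad >= 4 ^ t, while each factor has mean at most 2. *)
pose bad j (w : Omega) := theta < `|(row_err w j i)%:~R|.
pose g j (w : Omega) : R := if bad j w then 16 else 1.
apply: (@le_trans _ _ (prob R [pred w | 4 ^+ t <= \prod_(j in [set: 'I_t]) g j w])).
  apply: prob_sub => w /= le.
  have -> : \prod_(j in [set: 'I_t]) g j w = 4 ^+ (2 * #|~: good_rows i w|).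
    rewrite exprM -prodr_const [LHS]big_mkcond [RHS]big_mkcond; apply: eq_bigr => j _.
    by rewrite !inE /g /bad ltNge; case: ifP => //=; lra.
  rewrite ler_eXn2l ?ltr1n//; have := cardsC (good_rows i w); rewrite card_ord.
  by move: le; move: #|good_rows i w| #|~: good_rows i w| => x y; lia.
apply: le_trans (prob_markov _ _) _ => [w||].
- by apply: prodr_ge0 => j _; rewrite /g; case: ifP.
- by rewrite exprn_gt0.
rewrite ler_pdivrMr ?exprn_gt0//.
have -> : ((2 ^ t)%:R)^-1 * 4 ^+ t = \prod_(j in [set: 'I_t]) 2 :> R.
  rewrite prodr_const cardsT card_ord natrX -exprVn -exprMn; congr (_ ^+ _); lra.
apply: (avg_prod_le coin_gt0 (A := fun j => [set (inl (j, i') : coord) | i' in 'I_n])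
  (rk := fun=> 0%N)).
- move=> j j' x w _ _ jj' _; rewrite /g /bad.
  suff -> : row_err (splice [set (inl (j', i') : coord) | i' in 'I_n] x w) j i = row_err w j i by [].
  have hw i' : hash_of (splice [set (inl (j', i') : coord) | i' in 'I_n] x w) j i' = hash_of w j i'.
    rewrite /hash_of ffunE ifN//; apply: contraNN jj' => /imsetP[l _ [-> _]]; exact: eqxx.
  rewrite /row_err /sgn hw /sketch /=; congr (_ * _ - _).
  by apply: eq_big => l; rewrite /sgn hw.
- by move=> j w _; rewrite /g; case: ifP.
move=> j w _; rewrite (eq_avg (g := fun x => 1 + 15 * (bad j x)%:R)).
  rewrite (avgD (fun=> 1) (fun x => 15 * (bad j x)%:R)) avg_const ?card_Omega_gt0 ?coin_gt0// avgZ.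
  have := prob_row_bad j i; rewrite prob_avg -/(avg (fun x => (bad j x)%:R)); lra.
by move=> x; rewrite /g /bad row_err_local; case: (_ < _) => /=; lra.
Qed.

Hypothesis t0 : (0 < t)%N.
Hypothesis sq : 32 * s ^+ 2 * D.+1%:R * k%:R <= (2 ^ q)%:R.

Lemma s_rho : s * rho <= (8 * k%:R)^-1.
Proof.
have kR : 1 <= k%:R :> R by rewrite ler1n.
have q0 : 0 < (2 ^ q)%:R :> R by rewrite ltr0n expn_gt0.
rewrite /rho mulrA ler_pdivrMr// ler_pdivlMl; last by lra.
by apply: le_trans sq; rewrite le_eqVlt; apply/orP; left; apply/eqP; ring.
Qed.

Lemma rho_le1 : rho <= 1.
Proof.
have kR : 1 <= k%:R :> R by rewrite ler1n.
have q0 : 0 < (2 ^ q)%:R :> R by rewrite ltr0n expn_gt0.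
have r0 : 0 <= rho by rewrite /rho divr_ge0 ?(ltW q0)// mulr_ge0 ?ler0n// mulr_ge0//; move: s1; lra.
apply: (@le_trans _ _ (s * rho)); first by rewrite ler_peMl.
apply: le_trans s_rho _; rewrite invf_le1; lra.
Qed.

Lemma decode_close w i : good_sketch w -> good_rounding w ->
  (t < 2 * #|good_rows i w|)%N ->
  `|(decode Bd (hash_of w) (received w root) i)%:R - (subsum root i)%:R|
    <= tau root / Num.sqrt k%:R.
Proof.
move=> gs gr maj.
have kR : 1 <= k%:R :> R by rewrite ler1n.
have sk1 : 1 <= Num.sqrt k%:R :> R by rewrite -[leLHS]sqrtr1 ler_sqrt ?ler0n.
have th0 : 0 <= theta by rewrite divr_ge0 ?tau_ge0// mulr_ge0//; lra.
have E : s * (rho * tau root) <= theta.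
  rewrite mulrA /theta mulrC ler_wpM2l ?tau_ge0//; apply: le_trans s_rho _.
  rewrite lef_pV2 ?posrE; [|lra|lra].
  have : Num.sqrt k%:R <= k%:R :> R.
    by rewrite -[leRHS](sqr_sqrtr (ler0n R k)) expr2 ler_peMl// sqrtr_ge0.
  lra.
have -> : tau root / Num.sqrt k%:R = 2 * (theta + theta).
  by rewrite /theta; field; lra.
apply: decodeP t0 (subsumB _ _) maj _ _; first lra.
move=> j; rewrite inE => jg.
have -> : sgn (hash_of w) j i * received w root (j, (hash_of w j i).2) - (subsum root i)%:Z =
    row_err w j i + sgn (hash_of w) j i * err w root (j, (hash_of w j i).2).
  by rewrite /row_err /err; ring.
rewrite intr_norm intrD intrM; apply: le_trans (ler_normD _ _) _; apply: lerD => //.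
rewrite normrM /sgn rmorphXn/= rmorphN1 normrX normrN1 expr1n mul1r.
apply: le_trans E; exact: good_err rho_le1 gs gr _ _.
Qed.

Lemma prob_decode : 1 - (n%:R * ((2 ^ t)%:R)^-1 +
     (#|V| * (t * 2 ^ beta))%:R * (4 * expR (- (s ^+ 2 / 8)))) <=
  prob R [pred w : Omega | [forall i,
    `|(decode Bd (hash_of w) (received w root) i)%:R - (subsum root i)%:R|
      <= tau root / Num.sqrt k%:R]].
Proof.
pose bad (w : Omega) := [exists i, (2 * #|good_rows i w| <= t)%N] ||
  ([exists p : V * counter, s * tau p.1 < `|(sketch (hash_of w) (tail_sum p.1) p.2)%:~R : R|] ||
   [exists p : V * counter, s * (rho * tau p.1) <
      `|\sum_(u | sub par dep u p.1 && (u != p.1)) (delta' w u p.2)%:~R : R|]).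
apply: (@le_trans _ _ (prob R [pred w | ~~ bad w])); last first.
  apply: prob_sub => w /=; rewrite /bad !negb_or => /and3P[/existsPn h1 /existsPn h2 /existsPn h3].
  apply/forallP => i; apply: decode_close.
  - by move=> v b; rewrite leNgt; exact: (h2 (v, b)).
  - by move=> v b; rewrite leNgt; exact: (h3 (v, b)).
  by rewrite ltnNge; exact: h1.
rewrite prob_compl ?card_Omega_gt0 ?coin_gt0// lerD2l lerN2.
apply: le_trans (prob_or R _ _) _; apply: lerD.
  apply: le_trans (prob_exists R _) _.
  apply: le_trans (ler_sum _ (fun i _ => prob_majority_bad i)) _.
  by rewrite sumr_const card_ord -[_ *+ n]mulr_natl.
set X1 := expR _.
have cV : #|{: V * counter}| = (#|V| * (t * 2 ^ beta))%N by rewrite !card_prod !card_ord.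
apply: le_trans (prob_or R _ _) _.
rewrite (_ : 4 * X1 = 2 * X1 + 2 * X1); last by lra.
rewrite mulrDr; apply: lerD; apply: le_trans (prob_exists R _) _.
  apply: le_trans (ler_sum _ (fun p _ => prob_sketch_bad p.1 p.2)) _.
  by rewrite sumr_const cV -[_ *+ _]mulr_natl.
apply: le_trans (ler_sum _ (fun p _ => prob_rounding_bad p.1 p.2)) _.
by rewrite sumr_const cV -[_ *+ _]mulr_natl.
Qed.

End Restrict.
End Analysis.

(** * The protocol *)

Section Assembly.
Variable R : realType.

Lemma eq_card_bij (A B : finType) : #|A| = #|B| -> exists f : A -> B, bijective f.
Proof.
move=> AB; exists (fun x => enum_val (cast_ord AB (enum_rank x))).
exists (fun y => enum_val (cast_ord (esym AB) (enum_rank y))) => x.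
  by rewrite enum_valK cast_ordK enum_rankK.
by rewrite enum_valK cast_ordKV enum_rankK.
Qed.

Lemma prob_bij (A B : finType) (f : A -> B) (E : pred B) : bijective f ->
  prob R [pred x | E (f x)] = prob R E.
Proof.
move=> bf; rewrite !prob_avg /avg (bij_eq_card bf); congr (_ / _).
by rewrite [RHS](reindex f)//=; apply: onW_bij.
Qed.

Lemma mx_norm_le (n : nat) (x : 'rV[R]_n) (a : R) : 0 <= a ->
  (forall i, `|x 0 i| <= a) -> mx_norm x <= a.
Proof.
move=> a0 xa; have [->//|/mx_norm_neq0[[i j] ->]] := eqVneq (mx_norm x) 0.
by rewrite /= ord1.
Qed.

Lemma card_top (n k : nat) (x : 'rV[R]_n) : (#|[set i in top k x]| <= minn k n)%N.
Proof.
rewrite cardsE; apply: leq_trans (card_size _) _.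
by rewrite /top size_take_min size_sort size_enum_ord.
Qed.

Lemma coin_prob_prob r (E : pred (r.-tuple bool)) : coin_prob R E = prob R E.
Proof. by rewrite /coin_prob /prob card_tuple card_bool. Qed.

Variables (V : finType) (e : rel V) (root : V) (n M k k' t beta q N L : nat) (i0 : 'I_n) (s : R).
Hypothesis sym : symmetric e.
Hypothesis conn : forall u v : V, connect e u v.
Hypothesis k'k : (minn k' n <= k)%N.
Hypothesis k0 : (0 < k)%N.
Hypothesis k_beta : (512 * k <= 2 ^ beta)%N.
Hypothesis t0 : (0 < t)%N.
Hypothesis s1 : 1 <= s.
Hypothesis sN : 2 * s * (n * (#|V| * M))%:R < (2 ^ N)%:R.
Hypothesis sq : 32 * s ^+ 2 * (diameter e).+1%:R * k%:R <= (2 ^ q)%:R.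
Hypothesis card_msg : (#|msg n t beta k (#|V| * M) q N| <= 2 ^ L)%N.

Lemma sketch_protocol : exists (r : nat) (P : protocol V 'rV[nat]_n 'rV[R]_n r),
  forall X : V -> 'rV[nat]_n, (forall v i, (X v ord0 i <= M)%N) ->
  let S : 'rV[R]_n := map_mx (fun a : nat => a%:R) (\sum_v X v) in
  [/\ coin_prob R [pred w | mx_norm (result e P X w root - S)
                      <= l2norm (tail k' S) / Num.sqrt k%:R]
        >= 1 - (n%:R * ((2 ^ t)%:R)^-1 +
             (#|V| * (t * 2 ^ beta))%:R * (4 * expR (- (s ^+ 2 / 8)))),
      forall w, (total_comm e P X w <= #|V| * L)%N
    & forall w, (max_comm e P X w <= 2 * L)%N].
Proof.
have [par parP] := bfs_parent root conn.
pose dep := gdist e root; pose D := diameter e.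
have dep0 v : (dep v == 0%N) = (v == root) by rewrite /dep gdist_eq0// eq_sym.
have depS v : v != root -> dep v = (dep (par v)).+1 by move=> /parP[].
have depD v : (dep v <= D)%N by exact: gdist_diameter.
have e_par v : v != root -> e v (par v) by move=> /parP[ev _]; rewrite sym.
pose Om : finType := {ffun coord V n t beta -> coin beta N}.
pose r := (#|coord V n t beta| * (1 + beta + N))%N.
have [phi phi_bij] : exists phi : r.-tuple bool -> Om, bijective phi.
  apply: eq_card_bij; rewrite card_tuple card_bool card_ffun /coin !card_prod card_bool !card_ord.
  by rewrite /r mulnC expnM !expnD expn1.
have [P HP] := tree_protocol depS depD card_msg e_par
  (fun w v (x : 'rV[nat]_n) rcv => node_step i0 (phi w) v x rcv)
  (fun w x rcv => root_output R (phi w) x rcv).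
exists r, P => X XM S.
have msgE w := HP X w (msg_of root par dep D k (#|V| * M) q i0 X (phi w)) (fun v => messageE depS depD _ X v).
split=> [|w|w]; [|by case: (msgE w)|by case: (msgE w)].
pose T := [set i in top k' S].
have Tk : (#|T| <= k)%N by apply: leq_trans (card_top _ _) k'k.
have subsumB v i : (subsum par dep X v i <= #|V| * M)%N.
  rewrite /subsum -sum_nat_const big_mkcond; apply: leq_sum => u _.
  by case: ifP.
have SE i : S 0 i = (subsum par dep X root i)%:R.
  rewrite mxE summxE; congr (_%:R); apply: eq_bigl => u.
  by rewrite (sub_root dep0 depS).
have tauE : l2norm (tail k' S) = tau R par dep X T root.
  rewrite /l2norm /tau; congr Num.sqrt; rewrite /tau2 natr_sum; apply: eq_bigr => i _.
  rewrite natrX /tail_sum inE mxE SE; by case: ifP.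
rewrite coin_prob_prob.
have H := prob_decode dep0 depS depD i0 Tk subsumB s1 sN k0 k_beta t0 sq.
apply: le_trans H _; rewrite -(prob_bij _ phi_bij); apply: prob_sub => w /= /forallP ok.
rewrite tauE; apply: mx_norm_le; first by rewrite divr_ge0 ?tau_ge0 ?sqrtr_ge0.
move=> i; rewrite mxE [in X in _ + X]mxE SE.
by have [-> _ _] := msgE w; rewrite mxE; exact: ok.
Qed.

End Assembly.

(** * Choice of parameters *)

Section Bounds.
Variable R : realType.

Lemma expR_ge_pow2 (a : nat) : (2 ^ a)%:R <= expR a%:R :> R.
Proof.
rewrite -[a%:R]mulr1 expRM_natl natrX lerXn2r ?nnegrE ?expR_ge0//.
by have := @expR_ge1Dx R 1; lra.
Qed.

Lemma expR1_lt3 : expR 1 < 3 :> R.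
Proof.
have -> : 1 = 6%:R * 6^-1 :> R by rewrite divff.
rewrite expRM_natl -[6^-1]opprK expRN.
have H : 5 / 6 <= expR (- 6^-1) :> R by apply: le_trans (expR_ge1Dx _); lra.
have H0 : 0 < (5 / 6 : R) by lra.
apply: (@le_lt_trans _ _ ((5 / 6)^-1 ^+ 6)).
  by rewrite lerXn2r ?nnegrE ?invr_ge0 ?expR_ge0 ?(ltW H0)// lef_pV2 ?posrE ?expR_gt0.
by rewrite invf_div; lra.
Qed.

Lemma ln_nat_gt1 (n : nat) : (3 <= n)%N -> ln 3 <= ln n%:R :> R /\ 1 < ln 3 :> R.
Proof.
move=> n3; split; first by rewrite ler_ln ?posrE ?ltr0n ?ler_nat//; lia.
by rewrite -[X in X < _](@expRK R) ltr_ln ?posrE ?expR_gt0// expR1_lt3.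
Qed.

Lemma ln2_bounds : 2^-1 <= ln 2 :> R /\ ln 2 <= 1 :> R.
Proof.
split; last first.
  rewrite -[leRHS](@expRK R) ler_ln ?posrE ?expR_gt0//.
  by have := @expR_ge1Dx R 1; lra.
rewrite -[leLHS](@expRK R) ler_ln ?posrE ?expR_gt0//.
rewrite -[2^-1]opprK expRN invf_ple ?posrE ?expR_gt0//.
by apply: le_trans (expR_ge1Dx _); lra.
Qed.

Lemma ln_le_id (x : R) : 0 < x -> ln x <= x.
Proof.
move=> x0; have E : 1 + (x - 1) = x by lra.
have := @le_ln1Dx R (x - 1); rewrite E => H.
by apply: le_trans (H _) _; lra.
Qed.

Lemma up_log_le_ln (a : nat) : (0 < a)%N -> (up_log 2 a)%:R <= 1 + 2 * ln a%:R :> R.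
Proof.
case: a => [//|[_|a _]]; first by rewrite up_log1 ln1; lra.
have H := up_log_gtn (isT : (1 < 2)%N) (isT : (1 < a.+2)%N).
have u0 : (0 < up_log 2 a.+2)%N by rewrite up_log_gt0.
rewrite -(prednK u0) -natr1 addrC lerD2l.
have [h2 _] := ln2_bounds.
have : ln (2 ^ (up_log 2 a.+2).-1)%:R <= ln a.+2%:R :> R.
  by rewrite ler_ln ?posrE ?ltr0n ?expn_gt0// ler_nat ltnW.
rewrite natrX lnXn// -[_ *+ _]mulr_natl => le.
have u1 : 0 <= (up_log 2 a.+2).-1%:R :> R by [].
nra.
Qed.

Lemma up_log_pow_le (a : nat) : (0 < a)%N -> (2 ^ up_log 2 a <= 2 * a)%N.
Proof.
case: a => [//|[_|a _]]; first by rewrite up_log1.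
have H := up_log_gtn (isT : (1 < 2)%N) (isT : (1 < a.+2)%N).
have u0 : (0 < up_log 2 a.+2)%N by rewrite up_log_gt0.
by rewrite -(prednK u0) expnS leq_mul2l /= ltnW.
Qed.

Section ParameterChoice.
Variables (p n m M k D : nat).
Hypothesis n3 : (3 <= n)%N.
Hypothesis mn : (m <= n ^ p)%N.
Hypothesis Mn : (M <= n ^ p)%N.
Hypothesis k0 : (0 < k)%N.
Hypothesis kn : (k <= n)%N.

Definition lg := up_log 2 n.
Definition dev_const := (3 * p + 13)%N.
Definition num_rows := ((p + 2) * lg)%N.
Definition bucket_bits := up_log 2 (512 * k).
Definition deviation := (dev_const * lg)%N.
Definition dither_bits := ((2 * p + 3 + dev_const) * lg)%N.
Definition prec_bits := up_log 2 (32 * deviation ^ 2 * D.+1 * k).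
Definition width := (up_log 2 dither_bits.+1 + prec_bits + 2)%N.

Lemma lg_gt0 : (0 < lg)%N.
Proof. by rewrite up_log_gt0 (ltnW n3). Qed.

Lemma le_pow2_lg : (n <= 2 ^ lg)%N. Proof. exact: up_logP. Qed.

Lemma lg_le : (lg <= n)%N.
Proof. by apply: up_log_min => //; rewrite ltnW// ltn_expl. Qed.

Lemma pow_le_pow2_lg a : (n ^ a <= 2 ^ (a * lg))%N.
Proof. by case: a => [//|a]; rewrite mulnC expnM leq_exp2r// le_pow2_lg. Qed.

Lemma dither_bits_ok : 2 * deviation%:R * (n * (m * M))%:R < (2 ^ dither_bits)%:R :> R.
Proof.
clear - n3 mn Mn.
rewrite -!natrM ltr_nat.
have H1 : (dev_const < 2 ^ dev_const)%N by apply: ltn_expl.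
have lp := lg_gt0; have le_n := lg_le.
apply: (@leq_ltn_trans (2 * dev_const * n ^ (2 * p + 2))).
  have -> : (n ^ (2 * p + 2) = n * (n * (n ^ p * n ^ p)))%N.
    by rewrite expnD mulnn -expnM [(p * 2)%N]mulnC mulnC mulnA.
  by rewrite /deviation -!mulnA !leq_mul.
apply: (@leq_trans (2 * 2 ^ dev_const * 2 ^ ((2 * p + 2) * lg))).
  apply: (@leq_trans (2 * 2 ^ dev_const * n ^ (2 * p + 2))).
    by rewrite ltn_mul2r ltn_mul2l /= H1 andbT expn_gt0; lia.
  by rewrite leq_mul2l pow_le_pow2_lg orbT.
by rewrite -expnS -expnD leq_exp2l// /dither_bits; nia.
Qed.

Lemma prec_bits_ok : 32 * deviation%:R ^+ 2 * D.+1%:R * k%:R <= (2 ^ prec_bits)%:R :> R.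
Proof. by rewrite -natrX -!natrM ler_nat up_logP. Qed.

Definition msg_bits := (k * (lg + (2 * p * lg + 1)) + num_rows * 2 ^ bucket_bits * width)%N.

Lemma card_msg_le : (#|msg n num_rows bucket_bits k (m * M) prec_bits dither_bits| <= 2 ^ msg_bits)%N.
Proof.
clear - n3 mn Mn k0.
rewrite /msg card_prod !card_ffun !card_prod !card_ord /msg_bits expnD.
have lp := lg_gt0.
apply: leq_mul.
  rewrite [X in (_ <= 2 ^ X)%N]mulnC expnM leq_exp2r// expnD leq_mul ?le_pow2_lg//.
  rewrite expnD; have : (m * M <= 2 ^ (2 * p * lg))%N.
    by apply: leq_trans (pow_le_pow2_lg _); rewrite mul2n -addnn expnD leq_mul.
  have := expn_gt0 2 (2 * p * lg); lia.
have r0 : (0 < num_rows * 2 ^ bucket_bits)%N by rewrite !muln_gt0 lp expn_gt0 addn2.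
rewrite [X in (_ <= 2 ^ X)%N]mulnC [X in (_ <= X)%N]expnM leq_exp2r//.
rewrite /width -addnA expnD; apply: leq_mul; first exact: up_logP.
by rewrite expnD; have := expn_gt0 2 prec_bits; lia.
Qed.

Lemma failure_le :
  n%:R * ((2 ^ num_rows)%:R)^-1 + (m * (num_rows * 2 ^ bucket_bits))%:R * (4 * expR (- (deviation%:R ^+ 2 / 8)))
    <= ((n ^ p)%:R)^-1 :> R.
Proof.
clear - n3 mn k0 kn.
have lp := lg_gt0; have le_n := lg_le.
have nR : 3 <= n%:R :> R by rewrite ler_nat.
have n0 : 0 < n%:R :> R by lra.
have pw a : 0 < n%:R ^+ a :> R by rewrite exprn_gt0.
have inv2 a : ((2 ^ (a * lg))%:R)^-1 <= (n%:R ^+ a)^-1 :> R.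
  by rewrite lef_pV2 ?posrE ?ltr0n ?expn_gt0// -natrX ler_nat pow_le_pow2_lg.
have E : expR (- (deviation%:R ^+ 2 / 8)) <= (n%:R ^+ dev_const)^-1 :> R.
  apply: le_trans (inv2 dev_const); rewrite -/deviation expRN lef_pV2 ?posrE ?expR_gt0 ?ltr0n ?expn_gt0//.
  apply: le_trans (expR_ge_pow2 _) _; rewrite ler_expR.
  have : 13 <= deviation%:R :> R by rewrite ler_nat /deviation /dev_const; nia.
  by move: (deviation%:R : R) => x; nra.
have Q : (m * (num_rows * 2 ^ bucket_bits) * 4 <= n ^ (2 * p + 12))%N.
  have b1 : (2 ^ bucket_bits <= 1024 * n)%N.
    by apply: leq_trans (up_log_pow_le _) _; lia.
  have p2 : (p + 2 <= n ^ (p + 2))%N by rewrite ltnW// ltn_expl//; lia.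
  have c8 : (4096 <= n ^ 8)%N by apply: (@leq_trans (3 ^ 8)) => //; rewrite leq_exp2r.
  apply: (@leq_trans (n ^ p * (n ^ (p + 2) * n * n) * n ^ 8)).
    apply: (@leq_trans (n ^ p * ((p + 2) * n * n) * 4096)).
      apply: (@leq_trans (n ^ p * ((p + 2) * n * (1024 * n)) * 4)); last by nia.
      rewrite leq_mul2r /= leq_mul// /num_rows leq_mul// leq_mul//.
    by rewrite leq_mul// leq_mul// !leq_mul.
  rewrite -!mulnA -!expnS -!expnD leq_exp2l//; lia.
have Q' : (m * (num_rows * 2 ^ bucket_bits))%:R * 4 <= n%:R ^+ (2 * p + 12) :> R.
  by rewrite -natrX -natrM ler_nat.
have -> : (n ^ p)%:R^-1 = n%:R * (n%:R ^+ (p + 1))^-1 :> R.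
  by rewrite natrX addn1 exprS invfM mulrA divff ?mul1r// gt_eqF.
have h1 : n%:R * (2 ^ num_rows)%:R^-1 <= (n%:R ^+ (p + 1))^-1 :> R.
  apply: (@le_trans _ _ (n%:R * (n%:R ^+ (p + 2))^-1)); first by apply: ler_wpM2l (ltW n0) _ _ _; exact: inv2.
  by rewrite [(p + 2)%N]addnS exprS invfM mulrA divff ?mul1r// gt_eqF.
have h2 : (m * (num_rows * 2 ^ bucket_bits))%:R * (4 * expR (- (deviation%:R ^+ 2 / 8))) <= (n%:R ^+ (p + 1))^-1 :> R.
  rewrite mulrA; apply: (@le_trans _ _ (n%:R ^+ (2 * p + 12) * (n%:R ^+ dev_const)^-1)).
    by rewrite ler_pM ?expR_ge0// mulr_ge0.
  have -> : dev_const = ((2 * p + 12) + (p + 1))%N by rewrite /dev_const; lia.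
  by rewrite [n%:R ^+ (_ + (p + 1))]exprD invfM mulrA divff ?mul1r// gt_eqF.
have := invr_gt0 (n%:R ^+ (p + 1) : R); rewrite pw; move: h1 h2.
move: ((n%:R ^+ (p + 1))^-1 : R) => x h1 h2 x0; apply: le_trans (lerD h1 h2) _.
nra.
Qed.

Lemma msg_bits_le : (msg_bits <= 1026 * (p + 2) * (k * lg * width))%N.
Proof.
clear - n3 k0.
have b1 : (2 ^ bucket_bits <= 1024 * k)%N.
  by apply: leq_trans (up_log_pow_le _) _; lia.
have lp := lg_gt0.
have w2 : (2 <= width)%N by rewrite /width; lia.
rewrite /msg_bits /num_rows.
have h1 : (k * (lg + (2 * p * lg + 1)) <= 2 * (p + 2) * (k * lg * width))%N.
  apply: (@leq_trans (k * (lg * (2 * (p + 2))))); first by rewrite leq_mul2l; apply/orP; right; nia.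
  by have : (k * lg <= k * lg * width)%N by [rewrite leq_pmulr//; lia]; nia.
have h2 : ((p + 2) * lg * 2 ^ bucket_bits * width <= 1024 * (p + 2) * (k * lg * width))%N.
  apply: (@leq_trans ((p + 2) * lg * (1024 * k) * width)); last by nia.
  by rewrite leq_mul2r leq_mul2l b1 !orbT.
lia.
Qed.

Definition width_const : R := 2 * (2 * p + 4 + dev_const)%:R + 4 * dev_const%:R + 93.

Lemma width_le (x : R) : 0 <= x -> ln k%:R <= 1 + 2 * x ->
  width%:R <= width_const + 6 * ln (ln n%:R) + 2 * ln D%:R + 4 * x.
Proof.
clear - n3 k0.
move=> x0 kx; have lp := lg_gt0; have [lnn ln3] := ln_nat_gt1 n3.
have lR : lg%:R <= 3 * ln n%:R :> R.
  by have := up_log_le_ln (ltnW (ltnW n3)); rewrite -/lg; lra.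
have lnl : ln lg%:R <= 2 + ln (ln n%:R) :> R.
  apply: (@le_trans _ _ (ln (3 * ln n%:R))).
    by rewrite ler_ln ?posrE ?ltr0n//; lra.
  rewrite lnM ?posrE//; last by lra.
  rewrite lerD2r; have [_ h2] := ln2_bounds.
  apply: (@le_trans _ _ (ln (2 * 2))); first by rewrite ler_ln ?posrE//; lra.
  by rewrite lnM ?posrE//; lra.
have lnD : ln D.+1%:R <= 1 + ln D%:R :> R.
  case: D => [|D']; first by rewrite ln1 ln0//; lra.
  apply: (@le_trans _ _ (ln (2 * D'.+1%:R))).
    by rewrite ler_ln ?posrE ?mulr_gt0// -natrM ler_nat; lia.
  by rewrite lnM ?posrE//; have [_ h2] := ln2_bounds; lra.
have cs0 : (0 < dev_const)%N by rewrite /dev_const addn_gt0 orbT.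
have h1 : (up_log 2 dither_bits.+1)%:R <= 1 + 2 * ((2 * p + 4 + dev_const)%:R + (2 + ln (ln n%:R))) :> R.
  apply: le_trans (up_log_le_ln _) _ => //.
  rewrite lerD2l ler_wpM2l//.
  apply: (@le_trans _ _ (ln ((2 * p + 4 + dev_const) * lg)%:R)).
    rewrite ler_ln ?posrE ?ltr0n ?muln_gt0 ?lp ?addn_gt0 ?cs0 ?orbT// ler_nat /dither_bits; nia.
  rewrite natrM lnM ?posrE ?ltr0n ?addn_gt0 ?cs0 ?orbT//.
  by rewrite lerD// ln_le_id// ltr0n addn_gt0 cs0 orbT.
have h2 : prec_bits%:R <= 1 + 2 * (32 + 2 * (dev_const%:R + (2 + ln (ln n%:R))) + (1 + ln D%:R) + (1 + 2 * x)) :> R.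
  have dev0 : (0 < deviation)%N by rewrite muln_gt0 cs0.
  apply: le_trans (up_log_le_ln _) _; first by rewrite !muln_gt0 cs0 lp k0.
  rewrite lerD2l ler_wpM2l//.
  have -> : (32 * deviation ^ 2 * D.+1 * k)%:R = 32 * deviation%:R ^+ 2 * D.+1%:R * k%:R :> R.
    by rewrite -natrX -!natrM.
  rewrite lnM ?posrE ?mulr_gt0 ?exprn_gt0 ?ltr0n// lerD//.
  rewrite lnM ?posrE ?mulr_gt0 ?exprn_gt0 ?ltr0n// lerD//.
  rewrite lnM ?posrE ?mulr_gt0 ?exprn_gt0 ?ltr0n// lerD//; first exact: ln_le_id.
  rewrite lnXn ?ltr0n// -[_ *+ 2]mulr_natl ler_wpM2l// /deviation natrM lnM ?posrE ?ltr0n//.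
  by rewrite lerD// ln_le_id// ltr0n.
rewrite /width !natrD /width_const; lra.
Qed.

End ParameterChoice.
End Bounds.

Lemma powR_nat_bound (R : realType) (c c' K : R) : 1 <= c ->
  exists p : nat, forall n : nat, (3 <= n)%N ->
    [/\ K * n%:R `^ c' <= (n ^ p)%:R & n%:R `^ c <= (n ^ p)%:R].
Proof.
move=> c1; pose a := `|c'| + `|K| + c.
have a0 : 0 <= a by rewrite !addr_ge0//; lra.
exists (Num.bound a) => n n3.
have n1 : 1 <= n%:R :> R by rewrite ler1n; lia.
have ap : a <= (Num.bound a)%:R by rewrite ltW// archi_boundP.
have pE : (n ^ Num.bound a)%:R = n%:R `^ (Num.bound a)%:R :> R.
  by rewrite powR_mulrn ?natrX// ler0n.
have mono x : x <= a -> n%:R `^ x <= (n ^ Num.bound a)%:R.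
  by move=> xa; rewrite pE ler_powR// (le_trans xa).
split; last by apply: mono; rewrite lerDr addr_ge0.
apply: (@le_trans _ _ (n%:R `^ (`|K| + `|c'|))).
  rewrite powRD; last by apply/implyP => _; rewrite gt_eqF//; lra.
  have n0 : 0 < n%:R :> R by lra.
  apply: (@le_trans _ _ (`|K| * n%:R `^ c')).
    by rewrite ler_wpM2r ?powR_ge0// ler_norm.
  apply: ler_pM; rewrite ?powR_ge0//; last by rewrite ler_powR// ler_norm.
  have [lnn l3] := @ln_nat_gt1 R n n3.
  rewrite /powR gt_eqF//; apply: le_trans (expR_ge1Dx _).
  by have : `|K| <= `|K| * ln n%:R; [rewrite ler_peMr//; lra|lra].
by apply: mono; rewrite /a; lra.
Qed.

Lemma tail_eq0 (R : realType) (n k : nat) (x : 'rV[R]_n) : (n <= k)%N -> l2norm (tail k x) = 0.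
Proof.
move=> nk; rewrite /l2norm big1 ?sqrtr0// => i _.
rewrite mxE /top take_oversize ?size_sort ?size_enum_ord// mem_sort mem_enum.
by rewrite expr0n.
Qed.

Lemma msg_bits_factor (R : realType) (p : nat) : exists2 q : R, 0 < q &
  forall n k D, (3 <= n)%N -> (0 < k)%N ->
    (msg_bits p n k D)%:R <= q * (k%:R * (lg n)%:R * (width p n k D)%:R).
Proof.
exists (1026 * (p + 2))%:R; first by rewrite ltr0n muln_gt0 addn2.
move=> n k D n3 k0; have := msg_bits_le p D n3 k0.
by rewrite -(ler_nat R) natrM [X in _ <= _ * X]natrM [X in _ <= _ * (X * _)]natrM.
Qed.

Lemma msg_bits_bound (R : realType) (p : nat) : exists2 C : R, 0 < C &
  forall n k D (eps : R), (3 <= n)%N -> (0 < k)%N -> 0 < eps < 1 -> k%:R <= 2 * eps ^- 2 ->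
    2 * (msg_bits p n k D)%:R <=
      C * (eps ^- 2 * ln n%:R * (ln (ln n%:R) + ln D%:R + ln eps^-1)).
Proof.
have [q q0 Hq] := msg_bits_factor R p.
pose kappa : R := ln (ln 3).
have [_ ln3] := @ln_nat_gt1 R 3 isT.
have kappa0 : 0 < kappa by exact: ln_gt0.
have [cw cwE] : exists cw, cw = width_const R p by exists (width_const R p).
have cw0 : 0 < cw.
  have u (x : nat) : 0 <= x%:R :> R by [].
  by rewrite cwE /width_const; have := u (2 * p + 4 + dev_const p)%N; have := u (dev_const p); lra.
exists (12 * q * (cw / kappa + 6)); first by do 2 ?apply: mulr_gt0 => //; rewrite addr_gt0// divr_gt0.
move=> n k D eps n3 k0 /andP[e0 e1] kE.
have [lnn _] := @ln_nat_gt1 R n n3.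
have E0 : 0 < eps ^- 2 by rewrite invr_gt0 exprn_gt0.
have le0 : 0 < ln eps^-1 by rewrite ln_gt0// invf_gt1.
have lnk : ln k%:R <= 1 + 2 * ln eps^-1.
  apply: (@le_trans _ _ (ln (2 * eps ^- 2))); first by rewrite ler_ln ?posrE ?ltr0n// mulr_gt0.
  rewrite lnM ?posrE//; have [_ l2] := ln2_bounds R.
  by rewrite -exprVn lnXn ?invr_gt0// -[ln _ *+ 2]mulr_natl lerD.
have y0 : kappa <= ln (ln n%:R) by rewrite ler_ln ?posrE//; lra.
have ld0 : 0 <= ln D%:R :> R.
  by case: (D) => [|d']; [rewrite ln0|rewrite ln_ge0// ler1n].
have wG := width_le p D n3 k0 (ltW le0) lnk; rewrite -cwE in wG.
set G := ln (ln n%:R) + ln D%:R + ln eps^-1.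
have {}wG : (width p n k D)%:R <= (cw / kappa + 6) * G.
  apply: le_trans wG _.
  have h1 : cw <= cw / kappa * ln (ln n%:R).
    by rewrite mulrAC ler_pdivlMr// ler_wpM2l// ltW.
  have h2 : 0 <= cw / kappa * (ln D%:R + ln eps^-1).
    by rewrite mulr_ge0 ?divr_ge0 ?(ltW cw0) ?(ltW kappa0)// addr_ge0// ltW.
  by rewrite /G; lra.
have lR : (lg n)%:R <= 3 * ln n%:R :> R.
  by have := @up_log_le_ln R n (ltnW (ltnW n3)); rewrite /lg; lra.
apply: (@le_trans _ _ (2 * (q * (2 * eps ^- 2 * (3 * ln n%:R) * ((cw / kappa + 6) * G))))).
  rewrite ler_wpM2l//; apply: le_trans (Hq n k D n3 k0) _; rewrite ler_wpM2l ?(ltW q0)//.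
  by apply: ler_pM => //; apply: ler_pM.
by rewrite le_eqVlt; apply/orP; left; apply/eqP; ring.
Qed.

Theorem theorem13 (R : realType) (c c' K : R) (hc : 1 <= c) :
  exists2 C : R, 0 < C &
  forall (n M : nat) (V : finType) (e : rel V) (root : V) (eps : R),
    (3 <= n)%N ->
    symmetric e -> irreflexive e -> (forall u v : V, connect e u v) ->
    #|V|%:R <= K * n%:R `^ c' -> M%:R <= K * n%:R `^ c' ->
    0 < eps < 1 ->
    let d := diameter e in
    let B : R := C * (eps ^- 2 * ln n%:R *
                   (ln (ln n%:R) + ln d%:R + ln (eps^-1))) in
    exists (r : nat) (P : protocol V 'rV[nat]_n 'rV[R]_n r),
    forall X : V -> 'rV[nat]_n, (forall v i, (X v ord0 i <= M)%N) ->
      let S : 'rV[R]_n := map_mx (fun a : nat => a%:R) (\sum_v X v) in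
      [/\ coin_prob R
            [pred w | mx_norm (result e P X w root - S)
                      <= eps * l2norm (tail `|Num.ceil (eps ^- 2)|%N S)]
            >= 1 - (n%:R `^ c)^-1,
          forall w, (total_comm e P X w)%:R <= #|V|%:R * B
        & forall w, (max_comm e P X w)%:R <= B].
Proof.
have [p pP] := powR_nat_bound c' K hc.
have [C C0 HC] := msg_bits_bound R p.
exists C => //.
move=> n M V e root eps n3 sym _ conn Vn Mn e01 d B; have /andP[e0 e1] := e01.
have [Kn cn] := pP n n3.
have V0 : (0 < #|V|)%N by apply/card_gt0P; exists root.
have {}Vn : (#|V| <= n ^ p)%N by rewrite -(ler_nat R) (le_trans Vn).
have {}Mn : (M <= n ^ p)%N by rewrite -(ler_nat R) (le_trans Mn).
have n0 : (0 < n)%N by exact: leq_trans n3.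
pose i0 : 'I_n := Ordinal n0.
set E : R := eps ^- 2 in B *.
have E1 : 1 <= E by rewrite /E invf_ge1 ?exprn_gt0// expr_le1 ?(ltW e0) ?(ltW e1).
pose k' := `|Num.ceil E|%N.
have k'E : k'%:R = (Num.ceil E)%:~R :> R.
  by rewrite natr_absz ger0_norm// ceil_ge0; lra.
have k'1 : E <= k'%:R by rewrite k'E ceil_ge.
have k'2 : k'%:R <= 2 * E by rewrite k'E; have := ceilB1_lt E; rewrite intrB; lra.
have k'0 : (0 < k')%N by rewrite -(ltr_nat R); lra.
(* If k' > n the tail vanishes, and sparse lists of length n suffice to be exact. *)
pose k := minn k' n.
have k0 : (0 < k)%N by rewrite leq_min k'0.
have kn : (k <= n)%N by exact: geq_minr.
have kE : k%:R <= 2 * E.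
  by apply: le_trans k'2; rewrite ler_nat geq_minl.
have lp := lg_gt0 n3.
have rows0 : (0 < num_rows p n)%N by rewrite muln_gt0 lp addn2.
have dev1 : 1 <= (deviation p n)%:R :> R by rewrite ler1n muln_gt0 lp /dev_const addn_gt0 orbT.
have [r [P HP]] := sketch_protocol (k' := k') (t := num_rows p n) (beta := bucket_bits k)
  (q := prec_bits p n k d) (N := dither_bits p n) (L := msg_bits p n k d) (s := (deviation p n)%:R)
  root i0 sym conn (leqnn _) k0 (@up_logP 2 (512 * k) isT) rows0 dev1
  (dither_bits_ok R n3 Vn Mn) (prec_bits_ok R p n k d) (card_msg_le d n3 Vn Mn k0).
exists r, P => X XM S; have [H1 H2 H3] := HP X XM.
have LB : 2 * (msg_bits p n k d)%:R <= B by exact: HC.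
split.
- apply: le_trans (_ : 1 - ((n ^ p)%:R)^-1 <= _).
    by rewrite lerD2l lerN2 lef_pV2 ?posrE ?powR_gt0 ?ltr0n ?expn_gt0 ?n0.
  apply: le_trans (_ : _ <= coin_prob R _) _.
    by apply: le_trans H1; rewrite lerD2l lerN2; exact: failure_le.
  rewrite !coin_prob_prob; apply: prob_sub => w /= /le_trans; apply.
  rewrite mulrC; have [nk|_] := leqP n k'.
    by rewrite tail_eq0// !mulr0.
  rewrite ler_wpM2r ?sqrtr_ge0//.
  rewrite invf_ple ?posrE ?sqrtr_gt0 ?ltr0n//.
  rewrite -[leLHS]ger0_norm ?invr_ge0 ?(ltW e0)// -sqrtr_sqr ler_sqrt// exprVn.
  exact: k'1.
- move=> w; apply: (@le_trans _ _ (#|V| * msg_bits p n k d)%:R); first by rewrite ler_nat.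
  rewrite natrM ler_wpM2l//; apply: le_trans LB.
  by rewrite ler_peMl// ler1n.
- by move=> w; apply: le_trans LB; rewrite -natrM ler_nat.
Qed.
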